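(* Let $n\in\mathbb{N}$ and let $f_{2,n}=h_{2,n}+\overline{g_{2,n}}\in\mathcal{S}_H^0$ be such that $$h_{2,n}(z)-g_{2,n}(z)=\frac{z}{(1-z)^2}\quad\text{and}\quad \omega_n(z)=\frac{g_{2,n}'(z)}{h_{2,n}'(z)}=z^n .$$ (1) If $n=2m+1$ with $m\in\mathbb{N}$, then for all $z\in\mathbb{D}$ $$f_{2,n}(z)=\operatorname{Re}\left\{\frac{-z}{(1-z)^2}+\frac{(n-1)(n-2)}{3n}\frac{z}{1-z}+\frac{n-2}{n}\frac{z(2-z)}{(1-z)^2}+\frac{4}{3n}\frac{z(z^2-3z+3)}{(1-z)^3}+\frac{i}{2n}\sum_{k=1}^{(n-1)/2}\cot\frac{k\pi}{n}\csc^2\frac{k\pi}{n}\,\log\left(\frac{1-ze^{-i\frac{2k\pi}{n}}}{1-ze^{i\frac{2k\pi}{n}}}\right)\right\}+i\operatorname{Im}\left\{\frac{z}{(1-z)^2}\right\}.$$ (2) If $n=2m$ with $m\in\mathbb{N}$, then $f_{2,n}(\mathbb{D})$ lifts to the minimal surface $\mathbf{X}_{2,n}=(u,v,F(u,v))$, where, as functions of $z\in\mathbb{D}$, $$u=\operatorname{Re}\left\{\frac{-z}{(1-z)^2}+\frac{(n-1)(n-2)}{3n}\frac{z}{1-z}+\frac{n-2}{n}\frac{z(2-z)}{(1-z)^2}+\frac{4}{3n}\frac{z(z^2-3z+3)}{(1-z)^3}+\frac{i}{2n}\sum_{k=1}^{(n/2)-1}\cot\frac{k\pi}{n}\csc^2\frac{k\pi}{n}\,\log\left(\frac{1-ze^{-i\frac{2k\pi}{n}}}{1-ze^{i\frac{2k\pi}{n}}}\right)\right\},$$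 $$v=\operatorname{Im}\left\{\frac{z}{(1-z)^2}\right\},$$ $$F=\operatorname{Im}\left\{\frac{4-n^2}{6n}\frac{z}{1-z}-\frac2n\frac{z(2-z)}{(1-z)^2}+\frac{4}{3n}\frac{z(z^2-3z+3)}{(1-z)^3}+\frac{i}{2n}\sum_{k=1}^{(n/2)-1}(-1)^k\cot\frac{k\pi}{n}\csc^2\frac{k\pi}{n}\,\log\left(\frac{1-ze^{-i\frac{2k\pi}{n}}}{1-ze^{i\frac{2k\pi}{n}}}\right)\right\}.$$
   Context: $\mathbb{D}=\{z\in\mathbb{C}:|z|<1\}$; $\mathbb{N}=\{1,2,3,\dots\}$. $\mathcal{S}_H^0$ is the class of sense-preserving univalent (injective) harmonic mappings $f=h+\overline{g}$ on $\mathbb{D}$ with $h,g$ analytic, $h(0)=g(0)=0$, $h'(0)=1$, $g'(0)=0$. All logarithms denote the branch analytic on $\mathbb{D}$ that vanishes at $z=0$. Empty sums are $0$. ''$f(\mathbb{D})$ lifts to the minimal surface $\mathbf{X}=(u,v,F(u,v))$'', for a univalent harmonic $f=h+\overline g$ whose dilatation $g'/h'=q^2$ is the square of an analytic function $q$ (here $q(z)=z^{n/2}$), means: $f=u+iv$ on $\mathbb{D}$, the third coordinate is $2\operatorname{Im}\int_0^z h'(\zeta)q(\zeta)\,d\zeta$ (the Weierstrass–Enneper representation), and $z\mapsto(u,v,F)$ is an isothermal parametrization of a minimal graph over $f(\mathbb{D})$, so that the third coordinate is a function $F(u,v)$ of $u+iv\in f(\mathbb{D})$. *)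

(* Defs.v *)
From Stdlib Require Import Reals ClassicalEpsilon.
From Coquelicot Require Import Coquelicot.

Open Scope R_scope.

Definition disk (z : C) : Prop := Cmod z < 1.

(** [ex_derive] is used here at the absolute ring [C], i.e. it is complex
    differentiability. *)
Definition analytic_on_disk (F : C -> C) : Prop :=
  forall z : C, disk z -> @ex_derive C_AbsRing C_NormedModule F z.

Definition Cexp (z : C) : C :=
  (exp (Re z) * cos (Im z), exp (Re z) * sin (Im z)).

Definition is_log_branch (phi L : C -> C) : Prop :=
  analytic_on_disk L /\ L (RtoC 0) = RtoC 0 /\
  forall z : C, disk z -> Cexp (L z) = phi z.

(** The branch of [log phi] analytic on the disk and vanishing at [0]: it is
    unique on the disk, and exists whenever [phi] is analytic and zero-free on
    the disk with [phi 0 = 1]. *)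
Definition log_branch (phi : C -> C) : C -> C :=
  epsilon (inhabits (fun _ : C => RtoC 0)) (is_log_branch phi).

Definition cot (x : R) : R := cos x / sin x.
Definition csc (x : R) : R := / sin x.

(** Partial derivatives with respect to [x] and [y], where [z = x + iy]. *)
Definition Dx (u : C -> R) (z : C) : R := Derive (fun x => u (x, Im z)) (Re z).
Definition Dy (u : C -> R) (z : C) : R := Derive (fun y => u (Re z, y)) (Im z).

Definition jacobian (u v : C -> R) (z : C) : R :=
  Dx u z * Dy v z - Dy u z * Dx v z.

Definition sense_preserving (f : C -> C) : Prop :=
  forall z : C, disk z -> 0 < jacobian (fun w => Re (f w)) (fun w => Im (f w)) z.

Definition univalent (f : C -> C) : Prop :=
  forall z w : C, disk z -> disk w -> f z = f w -> z = w.

Definition SH0 (f h g : C -> C) : Prop :=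
  analytic_on_disk h /\ analytic_on_disk g /\
  (forall z : C, disk z -> f z = (h z + Cconj (g z))%C) /\
  sense_preserving f /\ univalent f /\
  h (RtoC 0) = RtoC 0 /\ g (RtoC 0) = RtoC 0 /\
  C_derive h (RtoC 0) = RtoC 1 /\ C_derive g (RtoC 0) = RtoC 0.

(** Integral from [0] to [z], along the segment joining them; for analytic
    integrands on the disk the path is immaterial. *)
Definition Cint0 (F : C -> C) (z : C) : C :=
  RInt (V := C_R_CompleteNormedModule) (fun t : R => (F (t * z) * z)%C) 0 1.

Definition vec3 : Type := (R * R * R)%type.
Definition crd1 (p : vec3) : R := fst (fst p).
Definition crd2 (p : vec3) : R := snd (fst p).
Definition crd3 (p : vec3) : R := snd p.

Definition dot (p q : vec3) : R :=
  crd1 p * crd1 q + crd2 p * crd2 q + crd3 p * crd3 q.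
Definition cross (p q : vec3) : vec3 :=
  (crd2 p * crd3 q - crd3 p * crd2 q,
   crd3 p * crd1 q - crd1 p * crd3 q,
   crd1 p * crd2 q - crd2 p * crd1 q).

Definition vec_x (X : C -> vec3) (z : C) : vec3 :=
  (Dx (fun w => crd1 (X w)) z, Dx (fun w => crd2 (X w)) z,
   Dx (fun w => crd3 (X w)) z).
Definition vec_y (X : C -> vec3) (z : C) : vec3 :=
  (Dy (fun w => crd1 (X w)) z, Dy (fun w => crd2 (X w)) z,
   Dy (fun w => crd3 (X w)) z).

(** First fundamental form. *)
Definition ffE (X : C -> vec3) (z : C) : R := dot (vec_x X z) (vec_x X z).
Definition ffF (X : C -> vec3) (z : C) : R := dot (vec_x X z) (vec_y X z).
Definition ffG (X : C -> vec3) (z : C) : R := dot (vec_y X z) (vec_y X z).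

Definition unit_normal (X : C -> vec3) (z : C) : vec3 :=
  let m := cross (vec_x X z) (vec_y X z) in
  let r := sqrt (dot m m) in
  (crd1 m / r, crd2 m / r, crd3 m / r).

(** Second fundamental form. *)
Definition sfL (X : C -> vec3) (z : C) : R :=
  dot (vec_x (vec_x X) z) (unit_normal X z).
Definition sfM (X : C -> vec3) (z : C) : R :=
  dot (vec_y (vec_x X) z) (unit_normal X z).
Definition sfN (X : C -> vec3) (z : C) : R :=
  dot (vec_y (vec_y X) z) (unit_normal X z).

Definition mean_curvature (X : C -> vec3) (z : C) : R :=
  (sfL X z * ffG X z - 2 * sfM X z * ffF X z + sfN X z * ffE X z) /
  (2 * (ffE X z * ffG X z - ffF X z ^ 2)).

Definition C2_on_disk (u : C -> R) : Prop :=
  forall z : C, disk z -> ex_diff_n (fun x y => u (x, y)) 2 (Re z) (Im z).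

Definition regular_surface (X : C -> vec3) : Prop :=
  C2_on_disk (fun z => crd1 (X z)) /\
  C2_on_disk (fun z => crd2 (X z)) /\
  C2_on_disk (fun z => crd3 (X z)) /\
  forall z : C, disk z -> cross (vec_x X z) (vec_y X z) <> (0, 0, 0).

Definition minimal_surface (X : C -> vec3) : Prop :=
  regular_surface X /\ forall z : C, disk z -> mean_curvature X z = 0.

Definition isothermal (X : C -> vec3) : Prop :=
  forall z : C, disk z -> ffE X z = ffG X z /\ ffF X z = 0.

(** [X] maps the disk bijectively onto the graph of [Phi] over the image of
    the disk under [f], and its tangent planes are never vertical; by the
    inverse function theorem [Phi] is then as smooth as [X]. *)
Definition graph_over_image (f : C -> C) (X : C -> vec3) : Prop :=
  univalent f /\
  (forall z : C, disk z -> f z = (crd1 (X z), crd2 (X z))) /\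
  (forall z : C, disk z ->
     jacobian (fun w => crd1 (X w)) (fun w => crd2 (X w)) z <> 0) /\
  exists Phi : R -> R -> R, forall z : C, disk z ->
    crd3 (X z) = Phi (crd1 (X z)) (crd2 (X z)).

(** The image of [f = h + conj g], with dilatation [q^2], lifts to the minimal
    graph [X] given by the Weierstrass-Enneper representation. *)
Definition lifts_to_minimal_surface (f h g q : C -> C) (X : C -> vec3) : Prop :=
  analytic_on_disk q /\
  (forall z : C, disk z -> (C_derive g z / C_derive h z = q z ^ 2)%C) /\
  (forall z : C, disk z ->
     X z = (Re (f z), Im (f z),
            2 * Im (Cint0 (fun w => (C_derive h w * q w)%C) z))) /\
  isothermal X /\ minimal_surface X /\ graph_over_image f X.

(** [(i/2n) sum_{k=1}^K s_k cot(k pi/n) csc(k pi/n)^2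
     log((1 - z exp(-2 i k pi/n)) / (1 - z exp(2 i k pi/n)))]; it is [0] for
    [K = 0]. *)
Definition log_sum (n K : nat) (s : nat -> R) (z : C) : C :=
  (Ci / RtoC (2 * INR n) *
   @sum_n_m C_AbelianMonoid
     (fun k : nat =>
        (RtoC (s k * (cot (INR k * PI / INR n) * csc (INR k * PI / INR n) ^ 2)) *
         log_branch
           (fun w => (1 - w * Cexp (- (Ci * RtoC (2 * INR k * PI / INR n)))) /
                     (1 - w * Cexp (Ci * RtoC (2 * INR k * PI / INR n)))) z)%C)
     1 K)%C.

Definition u_formula (n K : nat) (z : C) : R :=
  Re (- z / (1 - z) ^ 2
      + RtoC ((INR n - 1) * (INR n - 2) / (3 * INR n)) * (z / (1 - z))
      + RtoC ((INR n - 2) / INR n) * (z * (2 - z) / (1 - z) ^ 2)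
      + RtoC (4 / (3 * INR n)) * (z * (z ^ 2 - 3 * z + 3) / (1 - z) ^ 3)
      + log_sum n K (fun _ => 1%R) z)%C.

Definition v_formula (z : C) : R := Im (z / (1 - z) ^ 2)%C.

Definition F_formula (n K : nat) (z : C) : R :=
  Im (RtoC ((4 - INR n ^ 2) / (6 * INR n)) * (z / (1 - z))
      - RtoC (2 / INR n) * (z * (2 - z) / (1 - z) ^ 2)
      + RtoC (4 / (3 * INR n)) * (z * (z ^ 2 - 3 * z + 3) / (1 - z) ^ 3)
      + log_sum n K (fun k => ((-1) ^ k)%R) z)%C.

(* Main.v *)
From Stdlib Require Import Reals Lra Lia FunctionalExtensionality ClassicalEpsilon.
From Coquelicot Require Import Coquelicot.
Require Import Defs.

(** Solving [h' - g' = (1 + z) / (1 - z)^3], [g' = z^n h'] gives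
    [h' = (1 + z) / ((1 - z)^3 (1 - z^n))], so [u = Re (h + g)],
    [v = Im (h - g)] and [F = 2 Im int h' z^(n/2)] are determined, and the
    theorem is a partial fraction expansion.  After the pole part at [1] is
    subtracted, what remains of [2 h'] is [P(z) / (1 - z^n)] with [P] a
    polynomial of degree less than [n] whose coefficients are cubic in the
    exponent, and Lagrange interpolation at the [n]-th roots of unity expands
    it into simple fractions.  The roots [w^k] and [w^(n-k)] pair up to the
    logarithms of the formula.  For [n = 2m],
    [z^m / (1 - z^(2m)) = 1 / (1 - z^m) - 1 / (1 - z^(2m))] reduces [F] to the
    expansions for [m] and [2m].  The coordinates of the lift are real parts of
    holomorphic functions whose derivatives satisfy [p1^2 + p2^2 + p3^2 = 0],
    hence the map is isothermal and, being harmonic, minimal. *)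

Open Scope R_scope.

(** * Complex derivatives *)

(** [2 h'] has a pole of order 4 at [1], which is itself an [n]-th root of unity, so interpolation
    at all [n] roots could leave a simple fraction there. It does not: the residues at [w^k] and
    [w^(n-k)] are opposite and [2 h'] decays faster than [1 / z] at infinity, so the residue at [1]
    is zero. Hence the formula has no [log (1 - z)], and index 0 can stay in every sum over the
    roots with weight 0. Opposite residues are also why the logarithms come as quotients, and
    [cot csc^2] is the half-angle form of [(1 + w) / (1 - w)^3]. The logarithms of the statement are
    chosen by [epsilon], so only their specification is available; each closed form is therefore
    identified by its derivative and its value at 0, through integration along segments. An index
    [K] with [n = 2 K + 1] or [n = 2 K + 2] serves both parities: for even [n] the unpaired root
    [-1] has weight [cot (pi / 2) = 0]. *)

Definition Cder (F : C -> C) (z l : C) : Prop :=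
  @is_derive C_AbsRing C_NormedModule F z l.

(* [C_NormedModule] carries the product topology of [R * R], so Coquelicot's
   rules for functions from an absolute ring to itself do not apply to it
   directly. *)
Lemma Cder_AbsRing (F : C -> C) (z l : C) :
  Cder F z l <->
  @is_derive C_AbsRing (AbsRing_NormedModule C_AbsRing) F z l.
Proof.
  split; intros [_ H];
    (split; [apply (is_linear_scal_l (K := C_AbsRing)) | exact H]).
Qed.

Lemma Cder_eps (F : C -> C) (z l : C) :
  Cder F z l <->
  forall eps : R, 0 < eps -> exists delta : R, 0 < delta /\
    forall w : C, Cmod (w - z) < delta ->
      Cmod (F w - F z - (w - z) * l) <= eps * Cmod (w - z).
Proof.
  split.
  - intros [_ H] eps Heps.
    destruct (H z (fun P HP => HP) (mkposreal eps Heps)) as [d Hd].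
    exists d; split; [apply cond_pos|].
    intros w Hw; exact (Hd w Hw).
  - intros H; split; [apply (is_linear_scal_l (K := C_AbsRing))|].
    intros x Hx eps.
    assert (Hzx : z = x)
      by exact (@is_filter_lim_locally_unique C_AbsRing
                  (AbsRing_NormedModule C_AbsRing) z x Hx).
    subst x.
    destruct (H eps (cond_pos eps)) as [d [Hd Hw]].
    exists (mkposreal d Hd); intros w Hz; exact (Hw w Hz).
Qed.

Lemma Cder_ext (F G : C -> C) (z l l' : C) :
  (forall w, F w = G w) -> l = l' -> Cder F z l -> Cder G z l'.
Proof.
  intros HFG <- H; apply Cder_eps; intros eps Heps.
  destruct (proj1 (Cder_eps _ _ _) H eps Heps) as [d [Hd Hw]].
  exists d; split; [exact Hd|]; intros w; rewrite <- !HFG; apply Hw.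
Qed.

Lemma Cder_const (c z : C) : Cder (fun _ => c) z 0.
Proof. exact (@is_derive_const C_AbsRing C_NormedModule c z). Qed.

Lemma Cder_id (z : C) : Cder (fun w => w) z 1.
Proof. apply Cder_AbsRing; exact (@is_derive_id C_AbsRing z). Qed.

Lemma Cder_plus (F G : C -> C) (z l l' : C) :
  Cder F z l -> Cder G z l' -> Cder (fun w => F w + G w)%C z (l + l').
Proof. exact (@is_derive_plus C_AbsRing C_NormedModule F G z l l'). Qed.

Lemma Cder_opp (F : C -> C) (z l : C) :
  Cder F z l -> Cder (fun w => - F w)%C z (- l).
Proof. exact (@is_derive_opp C_AbsRing C_NormedModule F z l). Qed.

Lemma Cder_minus (F G : C -> C) (z l l' : C) :
  Cder F z l -> Cder G z l' -> Cder (fun w => F w - G w)%C z (l - l').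
Proof. exact (@is_derive_minus C_AbsRing C_NormedModule F G z l l'). Qed.

Lemma Cder_mult (F G : C -> C) (z l l' : C) :
  Cder F z l -> Cder G z l' ->
  Cder (fun w => F w * G w)%C z (l * G z + F z * l').
Proof.
  intros HF HG; apply Cder_AbsRing in HF; apply Cder_AbsRing in HG.
  apply Cder_AbsRing.
  exact (@is_derive_mult C_AbsRing F G z l l' HF HG Cmult_comm).
Qed.

Lemma Cder_comp (F G : C -> C) (z l l' : C) :
  Cder G z l -> Cder F (G z) l' -> Cder (fun w => F (G w)) z (l * l').
Proof.
  intros HG HF; apply Cder_AbsRing in HG.
  exact (@is_derive_comp C_AbsRing C_NormedModule F G z l' l HF HG).
Qed.

Lemma Cder_unique (F : C -> C) (z l l' : C) :
  Cder F z l -> Cder F z l' -> l = l'.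
Proof.
  intros H H'; rewrite <- (is_C_derive_unique F z l H).
  exact (is_C_derive_unique F z l' H').
Qed.

Lemma Cder_Cinv (z : C) : z <> 0%C -> Cder Cinv z (- / (z * z))%C.
Proof.
  intros Hz; apply Cder_eps; intros eps Heps.
  pose proof (proj1 (Cmod_gt_0 z) Hz) as Hm.
  set (m := Cmod z) in *.
  (* The first bound keeps [Cmod w] above [m / 2]; the second then makes the error factor
     [Cmod (w - z) / (m^2 * Cmod w)] at most [eps]. *)
  exists (Rmin (m / 2) (eps * m ^ 3 / 2)); split.
  { apply Rmin_pos; [lra|].
    pose proof (pow_lt m 3 Hm); nra. }
  intros w Hw.
  assert (H1 : Cmod (w - z) < m / 2)
    by (eapply Rlt_le_trans; [exact Hw | apply Rmin_l]).
  assert (H2 : Cmod (w - z) < eps * m ^ 3 / 2)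
    by (eapply Rlt_le_trans; [exact Hw | apply Rmin_r]).
  assert (H3 : m / 2 < Cmod w).
  { pose proof (Cmod_triangle w (- (w - z))) as T.
    rewrite Cmod_opp in T.
    replace (w + - (w - z))%C with z in T by ring.
    fold m in T; lra. }
  assert (Hw0 : w <> 0%C) by (apply Cmod_gt_0; lra).
  replace (/ w - / z - (w - z) * - / (z * z))%C
    with ((w - z) * (w - z) * / (z * z * w))%C
    by (field; split; assumption).
  assert (Hzz : (z * z * w)%C <> 0%C)
    by (repeat apply Cmult_neq_0; assumption).
  rewrite Cmod_mult, Cmod_inv, !Cmod_mult by exact Hzz; fold m.
  pose proof (Cmod_ge_0 (w - z)) as H0.
  set (r := Cmod (w - z)) in *.
  assert (Hq : r * / (m * m * Cmod w) <= eps).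
  { apply Rmult_le_reg_r with (m * m * Cmod w).
    - repeat apply Rmult_lt_0_compat; lra.
    - rewrite Rmult_assoc, Rinv_l by
        (apply Rgt_not_eq; repeat apply Rmult_lt_0_compat; lra).
      assert (m * m * (m / 2) <= m * m * Cmod w)
        by (apply Rmult_le_compat_l; nra).
      assert (eps * (m * m * (m / 2)) <= eps * (m * m * Cmod w))
        by (apply Rmult_le_compat_l; lra).
      replace (eps * m ^ 3 / 2) with (eps * (m * m * (m / 2))) in H2 by field.
      lra. }
  rewrite Rmult_assoc, Rmult_comm.
  apply Rmult_le_compat_r; assumption.
Qed.

Lemma Cder_inv (F : C -> C) (z l : C) :
  F z <> 0%C -> Cder F z l -> Cder (fun w => / F w)%C z (- l / (F z * F z))%C.
Proof.
  intros H0 H.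
  apply (Cder_ext (fun w => / F w)%C _ _ (l * - / (F z * F z))%C);
    [reflexivity | field; exact H0 |].
  apply Cder_comp; [exact H | apply Cder_Cinv; exact H0].
Qed.

Lemma Cmod_le_Re_Im (z : C) : Cmod z <= Rabs (Re z) + Rabs (Im z).
Proof.
  replace z with (RtoC (Re z) + Ci * RtoC (Im z))%C at 1.
  - eapply Rle_trans; [apply Cmod_triangle|].
    rewrite Cmod_mult, Cmod_Ci, !Cmod_R; lra.
  - destruct z as [x y]; unfold RtoC, Ci, Cplus, Cmult, Re, Im; simpl.
    f_equal; ring.
Qed.

(** The sufficient half of the Cauchy-Riemann criterion; each coordinate contributes an error of
    [eps / 2]. *)
Lemma Cder_of_differentiable (U V : R -> R -> R) (x y a b : R) :
  differentiable_pt_lim U x y a (- b) ->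
  differentiable_pt_lim V x y b a ->
  Cder (fun w => (U (Re w) (Im w), V (Re w) (Im w))) (x, y) (a, b).
Proof.
  intros HU HV; apply Cder_eps; intros eps Heps.
  assert (He : 0 < eps / 2) by lra.
  destruct (HU (mkposreal _ He)) as [d1 H1].
  destruct (HV (mkposreal _ He)) as [d2 H2].
  simpl in H1, H2.
  exists (Rmin d1 d2); split; [apply Rmin_pos; apply cond_pos|].
  intros [u v] Hw.
  pose proof (Rmin_l d1 d2); pose proof (Rmin_r d1 d2).
  pose proof (Rmax_Cmod ((u, v) - (x, y))%C) as Hm.
  simpl in Hm; fold (u - x) (v - y) in Hm.
  set (r := Cmod ((u, v) - (x, y))) in *.
  assert (Hu : Rabs (u - x) <= r) by (eapply Rle_trans; [apply Rmax_l | exact Hm]).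
  assert (Hv : Rabs (v - y) <= r) by (eapply Rle_trans; [apply Rmax_r | exact Hm]).
  specialize (H1 u v ltac:(lra) ltac:(lra)).
  specialize (H2 u v ltac:(lra) ltac:(lra)).
  eapply Rle_trans; [apply Cmod_le_Re_Im|].
  apply Rle_trans with (eps / 2 * r + eps / 2 * r); [|lra].
  assert (Hmm : eps / 2 * Rmax (Rabs (u - x)) (Rabs (v - y)) <= eps / 2 * r)
    by (apply Rmult_le_compat_l; lra).
  apply Rplus_le_compat; eapply Rle_trans; try exact Hmm.
  - eapply Rle_trans; [right | exact H1]; f_equal; simpl; ring.
  - eapply Rle_trans; [right | exact H2]; f_equal; simpl; ring.
Qed.

Lemma differentiable_of_partials (f : R -> R -> R) (x y : R)
  (fx : R -> R -> R) (fy : R) :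
  locally (x, y) (fun u : R * R =>
    is_derive (fun t => f t (snd u)) (fst u) (fx (fst u) (snd u))) ->
  is_derive (fun t => f x t) y fy ->
  continuous (fun u : R * R => fx (fst u) (snd u)) (x, y) ->
  differentiable_pt_lim f x y (fx x y) fy.
Proof.
  intros H1 H2 H3; apply filterdiff_differentiable_pt_lim.
  exact (is_derive_filterdiff f x y fx fy H1 H2 H3).
Qed.

Lemma continuous_real_pair (f g : R -> R) (u : R * R) :
  continuous f (fst u) -> continuous g (snd u) ->
  continuous (fun p : R * R => f (fst p) * g (snd p)) u.
Proof.
  intros Hf Hg.
  apply (continuous_mult (fun p : R * R => f (fst p)) (fun p : R * R => g (snd p))).
  - apply (continuous_comp (fun p : R * R => fst p) f); [apply continuous_fst | exact Hf].
  - apply (continuous_comp (fun p : R * R => snd p) g); [apply continuous_snd | exact Hg].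
Qed.

Lemma Cder_Cexp (z : C) : Cder Cexp z (Cexp z).
Proof.
  destruct z as [x y].
  apply (Cder_of_differentiable (fun x y => exp x * cos y)
           (fun x y => exp x * sin y) x y).
  - apply (differentiable_of_partials _ x y (fun x y => exp x * cos y)).
    + apply filter_forall; intros [u v]; simpl; auto_derive; [easy | ring].
    + simpl; auto_derive; [easy | ring].
    + apply continuous_real_pair; apply (ex_derive_continuous (V := R_NormedModule));
        auto_derive; easy.
  - apply (differentiable_of_partials _ x y (fun x y => exp x * sin y)).
    + apply filter_forall; intros [u v]; simpl; auto_derive; [easy | ring].
    + simpl; auto_derive; [easy | ring].
    + apply continuous_real_pair; apply (ex_derive_continuous (V := R_NormedModule));
        auto_derive; easy.
Qed.

(* The principal branch where [0 < Re z] only: [atan] loses the quadrant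
   elsewhere. *)
Definition Log (z : C) : C :=
  (ln (Re z ^ 2 + Im z ^ 2) / 2, atan (Im z / Re z)).

Lemma locally_Re_pos (x y : R) :
  0 < x -> locally (x, y) (fun u : R * R => 0 < fst u).
Proof.
  intros Hx; exists (mkposreal x Hx); intros [u v] [Hu _]; simpl in *.
  unfold ball in Hu; simpl in Hu; unfold AbsRing_ball, abs, minus, plus, opp in Hu;
    simpl in Hu.
  apply Rabs_def2 in Hu; lra.
Qed.

Lemma continuous_div_norm2 (f : R * R -> R) (x y : R) :
  0 < x -> continuous f (x, y) ->
  continuous (fun u : R * R => f u / (fst u ^ 2 + snd u ^ 2)) (x, y).
Proof.
  intros Hx Hf.
  apply (continuous_mult f (fun u : R * R => / (fst u ^ 2 + snd u ^ 2))).
  - exact Hf.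
  - apply (continuous_comp (fun u : R * R => fst u ^ 2 + snd u ^ 2) Rinv).
    + apply (continuous_plus (fun u : R * R => fst u ^ 2) (fun u : R * R => snd u ^ 2)).
      * apply (continuous_comp (fun p : R * R => fst p) (fun t => t ^ 2));
          [apply continuous_fst |].
        apply (ex_derive_continuous (V := R_NormedModule)); auto_derive; easy.
      * apply (continuous_comp (fun p : R * R => snd p) (fun t => t ^ 2));
          [apply continuous_snd |].
        apply (ex_derive_continuous (V := R_NormedModule)); auto_derive; easy.
    + apply (ex_derive_continuous (V := R_NormedModule)); simpl.
      auto_derive; nra.
Qed.

Lemma Cder_Log (z : C) : 0 < Re z -> Cder Log z (/ z)%C.
Proof.
  destruct z as [x y]; simpl; intros Hx.
  apply (Cder_ext Log _ _ (x / (x ^ 2 + y ^ 2), - y / (x ^ 2 + y ^ 2)));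
    [reflexivity | reflexivity |].
  apply (Cder_of_differentiable (fun x y => ln (x ^ 2 + y ^ 2) / 2)
           (fun x y => atan (y / x)) x y).
  - replace (- (- y / (x ^ 2 + y ^ 2))) with (y / (x ^ 2 + y ^ 2))
      by (field; nra).
    apply (differentiable_of_partials _ x y (fun x y => x / (x ^ 2 + y ^ 2))).
    + eapply filter_imp; [| apply (locally_Re_pos x y Hx)].
      intros [u v] Hu; simpl in *; auto_derive; [nra | field; nra].
    + auto_derive; [nra | field; nra].
    + apply (continuous_div_norm2 (fun u => fst u)); [exact Hx | apply continuous_fst].
  - apply (differentiable_of_partials _ x y (fun x y => - y / (x ^ 2 + y ^ 2))).
    + eapply filter_imp; [| apply (locally_Re_pos x y Hx)].
      intros [u v] Hu; simpl in *; auto_derive; [lra |].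
      field; split; nra.
    + auto_derive; [lra | field; split; nra].
    + apply (continuous_div_norm2 (fun u => - snd u)); [exact Hx |].
      apply (continuous_opp (fun u : R * R => snd u)); apply continuous_snd.
Qed.

Lemma Cexp_Log (z : C) : 0 < Re z -> Cexp (Log z) = z.
Proof.
  destruct z as [x y]; simpl; intros Hx.
  unfold Cexp, Log; simpl.
  rewrite cos_atan, sin_atan.
  replace (x * (x * 1) + y * (y * 1)) with (x * x * (1 + Rsqr (y / x)))
    by (unfold Rsqr; field; lra).
  assert (Hp : 0 < 1 + Rsqr (y / x)) by (pose proof (Rle_0_sqr (y / x)); lra).
  (* With [t = y / x], the cosine and sine of [atan t] have denominator [sqrt (1 + t^2)], so the
     modulus is written as [x * sqrt (1 + t^2)]; this uses [0 < x]. *)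
  assert (E : exp (ln (x * x * (1 + (y / x)²)) / 2) = x * sqrt (1 + (y / x)²)).
  { rewrite ln_mult by nra; rewrite ln_mult by lra.
    replace ((ln x + ln x + ln (1 + (y / x)²)) / 2)
      with (ln x + ln (1 + (y / x)²) / 2) by lra.
    rewrite exp_plus, exp_ln by exact Hx; f_equal.
    apply Rsqr_inj; [left; apply exp_pos | apply sqrt_pos |].
    rewrite Rsqr_sqrt by lra.
    unfold Rsqr at 1; rewrite <- exp_plus.
    replace (ln (1 + (y / x)²) / 2 + ln (1 + (y / x)²) / 2)
      with (ln (1 + (y / x)²)) by lra.
    apply exp_ln; exact Hp. }
  rewrite E.
  pose proof (sqrt_lt_R0 _ Hp).
  f_equal; field; lra.
Qed.

(** * Logarithms and primitives on the disk *)

Lemma disk_ball (z w : C) : disk z -> Cmod (w - z) < 1 - Cmod z -> disk w.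
Proof.
  unfold disk; intros Hz Hw.
  replace w with (z + (w - z))%C by ring.
  eapply Rle_lt_trans; [apply Cmod_triangle | lra].
Qed.

Lemma Cder_ext_disk (F G : C -> C) (z l : C) :
  disk z -> (forall w, disk w -> F w = G w) -> Cder F z l -> Cder G z l.
Proof.
  intros Hz HFG H; apply Cder_eps; intros eps Heps.
  destruct (proj1 (Cder_eps _ _ _) H eps Heps) as [d [Hd Hw]].
  exists (Rmin d (1 - Cmod z)); split.
  - apply Rmin_pos; [exact Hd | unfold disk in Hz; lra].
  - intros w Hwz; rewrite <- !HFG; try exact Hz.
    + apply Hw; eapply Rlt_le_trans; [exact Hwz | apply Rmin_l].
    + apply (disk_ball z w Hz); eapply Rlt_le_trans; [exact Hwz | apply Rmin_r].
Qed.

Lemma Cexp_plus (a b : C) : Cexp (a + b) = (Cexp a * Cexp b)%C.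
Proof.
  destruct a as [a1 a2], b as [b1 b2]; unfold Cexp, Cplus, Cmult, Re, Im; simpl.
  rewrite exp_plus, cos_plus, sin_plus; f_equal; ring.
Qed.

Lemma Cexp_0 : Cexp 0 = 1%C.
Proof.
  unfold Cexp, Re, Im; simpl; rewrite exp_0, cos_0, sin_0.
  unfold RtoC; f_equal; ring.
Qed.

Lemma Cexp_neq_0 (a : C) : Cexp a <> 0%C.
Proof.
  intros H; apply C1_nz.
  rewrite <- Cexp_0; replace (RtoC 0) with (a + - a)%C by ring.
  rewrite Cexp_plus, H; ring.
Qed.

Lemma Cexp_minus (a b : C) : Cexp (a - b) = (Cexp a / Cexp b)%C.
Proof.
  pose proof (Cexp_neq_0 b).
  replace (Cexp a) with (Cexp (a - b) * Cexp b)%C.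
  - field; assumption.
  - rewrite <- Cexp_plus; f_equal; ring.
Qed.

Lemma Cmod_Cexp (a : C) : Cmod (Cexp a) = exp (Re a).
Proof.
  unfold Cmod, Cexp; simpl.
  replace (exp (Re a) * cos (Im a) * (exp (Re a) * cos (Im a) * 1) +
           exp (Re a) * sin (Im a) * (exp (Re a) * sin (Im a) * 1))
    with (exp (Re a) * exp (Re a) * (Rsqr (sin (Im a)) + Rsqr (cos (Im a))))
    by (unfold Rsqr; ring).
  rewrite sin2_cos2, Rmult_1_r; apply sqrt_square; left; apply exp_pos.
Qed.

Lemma Re_one_minus_pos (w : C) : disk w -> 0 < Re (1 - w).
Proof.
  unfold disk; intros Hw.
  pose proof (re_le_Cmod w) as H; apply Rabs_le_between in H.
  destruct w as [x y]; simpl in *; lra.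
Qed.

Lemma one_minus_neq_0 (w : C) : disk w -> (1 - w)%C <> 0%C.
Proof.
  intros Hw H; apply Re_one_minus_pos in Hw; rewrite H in Hw.
  simpl in Hw; lra.
Qed.

Lemma disk_mult_unit (z e : C) : Cmod e = 1 -> disk z -> disk (z * e).
Proof. unfold disk; intros He Hz; rewrite Cmod_mult, He; lra. Qed.

Lemma Log_1 : Log 1 = 0%C.
Proof.
  unfold Log, RtoC; simpl.
  replace (1 * (1 * 1) + 0 * (0 * 1)) with 1 by ring.
  rewrite ln_1; unfold Rdiv; rewrite !Rmult_0_l, atan_0; reflexivity.
Qed.

Lemma Cder_Log_factor (e z : C) :
  Cmod e = 1 -> disk z ->
  Cder (fun w => Log (1 - w * e))%C z (- e / (1 - z * e))%C.
Proof.
  intros He Hz.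
  pose proof (disk_mult_unit z e He Hz) as Hze.
  apply (Cder_ext (fun w => Log (1 - w * e))%C _ _
           ((0 - (1 * e + z * 0)) * / (1 - z * e))%C).
  - reflexivity.
  - field; apply one_minus_neq_0; exact Hze.
  - apply (Cder_comp Log (fun w => 1 - w * e)%C).
    + apply Cder_minus; [apply Cder_const |].
      apply (Cder_mult (fun w => w) (fun _ => e)); [apply Cder_id | apply Cder_const].
    + apply Cder_Log; apply Re_one_minus_pos; exact Hze.
Qed.

(** Each factor [1 - w a] has positive real part on the disk, but the quotient may leave the right
    half-plane. The witness is therefore a difference of two values of [Log], not [Log] of the
    quotient. *)
Lemma log_branch_spec (a b : C) :
  Cmod a = 1 -> Cmod b = 1 ->
  is_log_branch (fun w => (1 - w * a) / (1 - w * b))%C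
    (log_branch (fun w => (1 - w * a) / (1 - w * b))%C).
Proof.
  intros Ha Hb; unfold log_branch; apply epsilon_spec.
  exists (fun w => Log (1 - w * a) - Log (1 - w * b))%C; split; [|split].
  - intros z Hz; eexists.
    apply (Cder_minus (fun w => Log (1 - w * a))%C (fun w => Log (1 - w * b))%C);
      apply Cder_Log_factor; assumption.
  - replace (1 - 0 * a)%C with (RtoC 1) by ring.
    replace (1 - 0 * b)%C with (RtoC 1) by ring.
    rewrite Log_1; ring.
  - intros z Hz; rewrite Cexp_minus, !Cexp_Log; [reflexivity | |];
      apply Re_one_minus_pos; apply disk_mult_unit; assumption.
Qed.

Lemma log_branch_0 (a b : C) :
  Cmod a = 1 -> Cmod b = 1 ->
  log_branch (fun w => (1 - w * a) / (1 - w * b))%C 0 = 0%C.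
Proof. intros Ha Hb; apply (log_branch_spec a b Ha Hb). Qed.

Lemma Cder_linear_factor (e z : C) : Cder (fun w => 1 - w * e)%C z (- e).
Proof.
  apply (Cder_ext (fun w => 1 - w * e)%C _ _ (0 - (1 * e + z * 0))%C);
    [reflexivity | ring |].
  apply Cder_minus; [apply Cder_const |].
  apply (Cder_mult (fun w => w) (fun _ => e)); [apply Cder_id | apply Cder_const].
Qed.

(** Differentiating [Cexp (L w) = phi w] in two ways gives [l * phi = phi'], which determines [l]
    whichever branch [epsilon] has selected. *)
Lemma Cder_log_branch (a b z : C) :
  Cmod a = 1 -> Cmod b = 1 -> disk z ->
  Cder (log_branch (fun w => (1 - w * a) / (1 - w * b))%C) z
    (- a / (1 - z * a) + b / (1 - z * b))%C.
Proof.
  intros Ha Hb Hz.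
  destruct (log_branch_spec a b Ha Hb) as [Hd [_ He]].
  set (L := log_branch _) in *.
  assert (exists l : C, Cder L z l) as [l Hl] by exact (Hd z Hz).
  pose proof (one_minus_neq_0 _ (disk_mult_unit z a Ha Hz)) as Na.
  pose proof (one_minus_neq_0 _ (disk_mult_unit z b Hb Hz)) as Nb.
  pose proof (Cder_comp Cexp L z l _ Hl (Cder_Cexp (L z))) as H1.
  apply (Cder_ext_disk _ _ z _ Hz He) in H1.
  rewrite He in H1 by exact Hz.
  pose proof (Cder_mult _ _ z _ _ (Cder_linear_factor a z)
                (Cder_inv _ z _ Nb (Cder_linear_factor b z))) as H2.
  pose proof (Cder_unique _ _ _ _ H1 H2) as E.
  replace (- a / (1 - z * a) + b / (1 - z * b))%C with l; [exact Hl|].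
  replace l with (l * ((1 - z * a) / (1 - z * b)) *
                  ((1 - z * b) / (1 - z * a)))%C by (field; auto).
  rewrite E; field; auto.
Qed.

Lemma is_derive_R_eps (f : R -> R) (x l : R) :
  (forall eps : R, 0 < eps -> exists delta : R, 0 < delta /\
    forall y : R, Rabs (y - x) < delta ->
      Rabs (f y - f x - (y - x) * l) <= eps * Rabs (y - x)) ->
  is_derive f x l.
Proof.
  intros H; split; [apply (is_linear_scal_l (K := R_AbsRing))|].
  intros y Hy eps.
  assert (Hxy : x = y)
    by exact (@is_filter_lim_locally_unique R_AbsRing
                (AbsRing_NormedModule R_AbsRing) x y Hy).
  subst y.
  destruct (H eps (cond_pos eps)) as [d [Hd Hw]].
  exists (mkposreal d Hd); intros w Hz; exact (Hw w Hz).
Qed.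

(** The bridge from complex to real derivatives: [b = z] serves integrals along segments, [b = 1]
    and [b = Ci] the two partial derivatives. *)
Lemma is_derive_Re_line (F : C -> C) (z b l : C) (t : R) :
  Cder F (z + t * b)%C l ->
  is_derive (fun s : R => Re (F (z + s * b)%C)) t (Re (b * l)%C).
Proof.
  intros H; apply is_derive_R_eps; intros eps Heps.
  pose proof (Cmod_ge_0 b) as Hb.
  (* The [+ 1] covers [b = 0]. *)
  assert (He : 0 < eps / (Cmod b + 1)) by (apply Rdiv_lt_0_compat; lra).
  destruct (proj1 (Cder_eps _ _ _) H _ He) as [d [Hd Hw]].
  exists (d / (Cmod b + 1)); split; [apply Rdiv_lt_0_compat; lra|].
  intros s Hs.
  assert (E : (z + s * b - (z + t * b) = RtoC (s - t) * b)%C)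
    by (rewrite RtoC_minus; ring).
  assert (Hm : Cmod (RtoC (s - t) * b) = Rabs (s - t) * Cmod b)
    by (rewrite Cmod_mult, Cmod_R; reflexivity).
  pose proof (Rabs_pos (s - t)) as Hp.
  specialize (Hw (z + s * b)%C); rewrite E, Hm in Hw.
  assert (Hlt : Rabs (s - t) * (Cmod b + 1) < d).
  { apply (Rmult_lt_compat_r (Cmod b + 1)) in Hs; [|lra].
    replace (d / (Cmod b + 1) * (Cmod b + 1)) with d in Hs by (field; lra).
    exact Hs. }
  specialize (Hw ltac:(nra)).
  replace (Re (F (z + s * b)%C) - Re (F (z + t * b)%C) - (s - t) * Re (b * l)%C)
    with (Re (F (z + s * b) - F (z + t * b) - RtoC (s - t) * b * l)%C).
  2:{ rewrite <- Cmult_assoc; unfold Cminus.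
      rewrite !re_plus, !re_opp, re_scal_l; ring. }
  eapply Rle_trans; [apply re_le_Cmod|].
  eapply Rle_trans; [exact Hw|].
  apply Rle_trans with (eps / (Cmod b + 1) * (Rabs (s - t) * (Cmod b + 1))).
  - apply Rmult_le_compat_l; nra.
  - right; field; lra.
Qed.

Lemma Im_as_Re (c : C) : Im c = Re (- Ci * c)%C.
Proof. destruct c as [x y]; simpl; ring. Qed.

Lemma is_derive_Im_line (F : C -> C) (z b l : C) (t : R) :
  Cder F (z + t * b)%C l ->
  is_derive (fun s : R => Im (F (z + s * b)%C)) t (Im (b * l)%C).
Proof.
  intros H.
  apply (is_derive_ext (fun s : R => Re ((- Ci) * F (z + s * b))%C)).
  { intros s; symmetry; apply Im_as_Re. }
  rewrite Im_as_Re.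
  replace (- Ci * (b * l))%C with (b * (0 * F (z + t * b) + - Ci * l))%C by ring.
  apply (is_derive_Re_line (fun w => (- Ci) * F w)%C).
  apply (Cder_mult (fun _ => - Ci)%C F); [apply Cder_const | exact H].
Qed.

Lemma disk_segment (z : C) (t : R) : disk z -> 0 <= t <= 1 -> disk (0 + t * z).
Proof.
  unfold disk; intros Hz Ht.
  rewrite Cplus_0_l, Cmod_mult, Cmod_R, Rabs_right by lra.
  pose proof (Cmod_ge_0 z); nra.
Qed.

(** The real fundamental theorem of calculus for each coordinate along the segment;
    differentiability of [f] supplies continuity of the integrand. *)
Lemma Cint0_primitive (F f : C -> C) (z : C) :
  (forall w, disk w -> Cder F w (f w)) ->
  (forall w, disk w -> exists l, Cder f w l) ->
  disk z -> Cint0 f z = (F z - F 0)%C.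
Proof.
  intros HF Hf Hz.
  unfold Cint0; apply (is_RInt_unique (V := C_R_CompleteNormedModule)).
  assert (D : forall t, Rmin 0 1 <= t <= Rmax 0 1 -> disk (0 + t * z)).
  { intros t; rewrite Rmin_left, Rmax_right by lra; apply disk_segment, Hz. }
  assert (Hg : forall t, Rmin 0 1 <= t <= Rmax 0 1 ->
            exists l, Cder (fun w => z * f w)%C (0 + t * z)%C l).
  { intros t Ht; destruct (Hf _ (D t Ht)) as [l Hl]; eexists.
    apply (Cder_mult (fun _ => z) f); [apply Cder_const | exact Hl]. }
  replace (F z - F 0)%C with
    (minus (Re (F (0 + RtoC 1 * z)%C)) (Re (F (0 + RtoC 0 * z)%C)),
     minus (Im (F (0 + RtoC 1 * z)%C)) (Im (F (0 + RtoC 0 * z)%C))).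
  2:{ replace (0 + RtoC 1 * z)%C with z by ring.
      replace (0 + RtoC 0 * z)%C with (RtoC 0) by ring.
      reflexivity. }
  apply (is_RInt_fct_extend_pair (U := R_NormedModule) (V := R_NormedModule)).
  - apply (is_RInt_ext (fun t : R => Re (z * f (0 + t * z))%C)).
    { intros t _; rewrite Cplus_0_l, Cmult_comm; reflexivity. }
    apply (is_RInt_derive (V := R_CompleteNormedModule)
             (fun t : R => Re (F (0 + t * z)%C))).
    + intros t Ht; apply is_derive_Re_line, HF, D, Ht.
    + intros t Ht; destruct (Hg t Ht) as [l Hl].
      apply (ex_derive_continuous (V := R_NormedModule)).
      eexists; apply (is_derive_Re_line (fun w => z * f w)%C), Hl.
  - apply (is_RInt_ext (fun t : R => Im (z * f (0 + t * z))%C)).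
    { intros t _; rewrite Cplus_0_l, Cmult_comm; reflexivity. }
    apply (is_RInt_derive (V := R_CompleteNormedModule)
             (fun t : R => Im (F (0 + t * z)%C))).
    + intros t Ht; apply is_derive_Im_line, HF, D, Ht.
    + intros t Ht; destruct (Hg t Ht) as [l Hl].
      apply (ex_derive_continuous (V := R_NormedModule)).
      eexists; apply (is_derive_Im_line (fun w => z * f w)%C), Hl.
Qed.

Lemma primitive_unique (F G f : C -> C) (z : C) :
  (forall w, disk w -> Cder F w (f w)) ->
  (forall w, disk w -> Cder G w (f w)) ->
  (forall w, disk w -> exists l, Cder f w l) ->
  F 0 = G 0 -> disk z -> F z = G z.
Proof.
  intros HF HG Hf H0 Hz.
  pose proof (Cint0_primitive F f z HF Hf Hz) as E1.
  rewrite (Cint0_primitive G f z HG Hf Hz), H0 in E1.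
  replace (F z) with (F z - G 0 + G 0)%C by ring.
  rewrite <- E1; ring.
Qed.

(** * Surfaces with harmonic coordinates *)

(** The successive derivatives are exhibited as functions, so that smoothness of rational
    expressions follows from the differentiation rules alone, without Cauchy's theory. *)
Fixpoint csmooth (k : nat) (F : C -> C) : Prop :=
  match k with
  | O => True
  | S j => exists f, (forall z, disk z -> Cder F z (f z)) /\ csmooth j f
  end.

Lemma csmooth_S (k : nat) (F : C -> C) : csmooth (S k) F -> csmooth k F.
Proof.
  revert F; induction k as [|k IH]; intros F H; [exact I|].
  destruct H as [f [Hf H]]; exists f; split; [exact Hf | apply IH, H].
Qed.

Lemma csmooth_const (k : nat) (c : C) : csmooth k (fun _ => c).
Proof.
  revert c; induction k as [|k IH]; intros c; [exact I|].
  exists (fun _ => RtoC 0); split; [intros; apply Cder_const | apply IH].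
Qed.

Lemma csmooth_id (k : nat) : csmooth k (fun z => z).
Proof.
  destruct k as [|k]; [exact I|].
  exists (fun _ => RtoC 1); split; [intros; apply Cder_id | apply csmooth_const].
Qed.

Lemma csmooth_plus (k : nat) (F G : C -> C) :
  csmooth k F -> csmooth k G -> csmooth k (fun z => F z + G z)%C.
Proof.
  revert F G; induction k as [|k IH]; intros F G; [easy|].
  intros [f [Hf Hf']] [g [Hg Hg']].
  exists (fun z => f z + g z)%C; split.
  - intros z Hz; apply Cder_plus; auto.
  - apply IH; assumption.
Qed.

Lemma csmooth_mult (k : nat) (F G : C -> C) :
  csmooth k F -> csmooth k G -> csmooth k (fun z => F z * G z)%C.
Proof.
  revert F G; induction k as [|k IH]; intros F G; [easy|].
  intros HF HG.
  pose proof (csmooth_S _ _ HF) as HF'; pose proof (csmooth_S _ _ HG) as HG'.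
  destruct HF as [f [Hf Hfk]], HG as [g [Hg Hgk]].
  exists (fun z => f z * G z + F z * g z)%C; split.
  - intros z Hz; apply Cder_mult; auto.
  - apply csmooth_plus; apply IH; assumption.
Qed.

Lemma csmooth_opp (k : nat) (F : C -> C) :
  csmooth k F -> csmooth k (fun z => - F z)%C.
Proof.
  revert F; induction k as [|k IH]; intros F; [easy|].
  intros [f [Hf Hf']]; exists (fun z => - f z)%C; split.
  - intros z Hz; apply Cder_opp; auto.
  - apply IH, Hf'.
Qed.

Lemma csmooth_inv (k : nat) (F : C -> C) :
  (forall z, disk z -> F z <> 0%C) -> csmooth k F -> csmooth k (fun z => / F z)%C.
Proof.
  intros H0; induction k as [|k IH]; [easy|].
  intros HF; pose proof (IH (csmooth_S _ _ HF)) as HI.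
  destruct HF as [f [Hf Hfk]].
  exists (fun z => - f z * (/ F z * / F z))%C; split.
  - intros z Hz.
    apply (Cder_ext (fun w => / F w)%C _ _ (- f z / (F z * F z))%C);
      [reflexivity | field; auto |].
    apply Cder_inv; auto.
  - apply csmooth_mult; [apply csmooth_opp, Hfk | apply csmooth_mult; exact HI].
Qed.

Lemma csmooth_pow (k m : nat) (F : C -> C) :
  csmooth k F -> csmooth k (fun z => F z ^ m)%C.
Proof.
  intros HF; induction m as [|m IH]; simpl; [apply csmooth_const|].
  apply csmooth_mult; assumption.
Qed.

Lemma horizontal_line (x y : R) : (x, y) = ((0, y) + RtoC x * 1)%C.
Proof. unfold RtoC, Cplus, Cmult; simpl; f_equal; ring. Qed.

Lemma vertical_line (x y : R) : (x, y) = ((x, 0) + RtoC y * Ci)%C.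
Proof. unfold RtoC, Ci, Cplus, Cmult; simpl; f_equal; ring. Qed.

Lemma is_derive_Re_x (F : C -> C) (x y : R) (l : C) :
  Cder F (x, y) l -> is_derive (fun t => Re (F (t, y))) x (Re l).
Proof.
  rewrite horizontal_line; intros H.
  apply is_derive_Re_line in H; rewrite Cmult_1_l in H.
  apply (is_derive_ext (fun s : R => Re (F ((0, y) + s * 1)%C))); [|exact H].
  intros t; rewrite <- horizontal_line; reflexivity.
Qed.

Lemma is_derive_Re_y (F : C -> C) (x y : R) (l : C) :
  Cder F (x, y) l -> is_derive (fun t => Re (F (x, t))) y (Re (Ci * l)%C).
Proof.
  rewrite vertical_line; intros H.
  apply is_derive_Re_line in H.
  apply (is_derive_ext (fun s : R => Re (F ((x, 0) + s * Ci)%C))); [|exact H].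
  intros t; rewrite <- vertical_line; reflexivity.
Qed.

Lemma Dx_Re (F : C -> C) (z l : C) : Cder F z l -> Dx (fun w => Re (F w)) z = Re l.
Proof.
  destruct z as [x y]; intros H.
  apply is_derive_unique, is_derive_Re_x, H.
Qed.

Lemma Dy_Re (F : C -> C) (z l : C) :
  Cder F z l -> Dy (fun w => Re (F w)) z = Re (Ci * l)%C.
Proof.
  destruct z as [x y]; intros H.
  apply is_derive_unique, is_derive_Re_y, H.
Qed.

Lemma disk_locally_2d (x y : R) :
  disk (x, y) -> locally_2d (fun u v => disk (u, v)) x y.
Proof.
  intros H; pose proof H as H'; unfold disk in H'.
  assert (Hd : 0 < (1 - Cmod (x, y)) / 2) by lra.
  exists (mkposreal _ Hd); simpl; intros u v Hu Hv.
  apply (disk_ball (x, y)); [exact H|].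
  eapply Rle_lt_trans; [apply Cmod_le_Re_Im|].
  simpl; fold (u - x) (v - y); lra.
Qed.

Lemma Dx_ext_disk (u v : C -> R) (z : C) :
  disk z -> (forall w, disk w -> u w = v w) -> Dx u z = Dx v z.
Proof.
  destruct z as [x y]; intros Hz H; apply Derive_ext_loc.
  eapply filter_imp; [| apply locally_2d_1d_const_y, (disk_locally_2d x y Hz)].
  intros t Ht; apply H, Ht.
Qed.

Lemma Dy_ext_disk (u v : C -> R) (z : C) :
  disk z -> (forall w, disk w -> u w = v w) -> Dy u z = Dy v z.
Proof.
  destruct z as [x y]; intros Hz H; apply Derive_ext_loc.
  eapply filter_imp; [| apply locally_2d_1d_const_x, (disk_locally_2d x y Hz)].
  intros t Ht; apply H, Ht.
Qed.

Lemma continuity_2d_Re (F : C -> C) (x y : R) (l : C) :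
  Cder F (x, y) l -> continuity_2d_pt (fun u v => Re (F (u, v))) x y.
Proof.
  intros H eps.
  destruct (proj1 (Cder_eps _ _ _) H 1 Rlt_0_1) as [d [Hd Hw]].
  pose proof (cond_pos eps) as He.
  pose proof (Cmod_ge_0 l) as Hl.
  assert (Hq : 0 < eps / (Cmod l + 2)) by (apply Rdiv_lt_0_compat; lra).
  assert (Hm : 0 < Rmin d (eps / (Cmod l + 2)) / 2)
    by (pose proof (Rmin_pos _ _ Hd Hq); lra).
  exists (mkposreal _ Hm); simpl; intros u v Hu Hv.
  assert (Hr : Cmod ((u, v) - (x, y)) < Rmin d (eps / (Cmod l + 2))).
  { eapply Rle_lt_trans; [apply Cmod_le_Re_Im|].
    simpl; fold (u - x) (v - y); lra. }
  pose proof (Rmin_l d (eps / (Cmod l + 2))).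
  pose proof (Rmin_r d (eps / (Cmod l + 2))).
  specialize (Hw (u, v) ltac:(lra)).
  set (D := ((u, v) - (x, y))%C) in *.
  replace (Re (F (u, v)) - Re (F (x, y)))
    with (Re ((F (u, v) - F (x, y) - D * l) + D * l)%C).
  2:{ unfold Cminus; rewrite !re_plus, !re_opp; ring. }
  eapply Rle_lt_trans; [apply re_le_Cmod|].
  eapply Rle_lt_trans; [apply Cmod_triangle|].
  rewrite (Cmod_mult D l).
  apply Rle_lt_trans with (Cmod D * (Cmod l + 2)).
  - pose proof (Cmod_ge_0 D); lra.
  - apply Rlt_le_trans with (eps / (Cmod l + 2) * (Cmod l + 2)).
    + apply Rmult_lt_compat_r; lra.
    + right; field; lra.
Qed.

(** The partial derivatives of [Re F] are [Re f] and [Re (Ci * f)], again real parts of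
    differentiable functions, which closes the induction. The extra order in [csmooth (S k)] pays
    for continuity at the last level. *)
Lemma ex_diff_n_Re (k : nat) (F : C -> C) (x y : R) :
  csmooth (S k) F -> disk (x, y) ->
  ex_diff_n (fun u v => Re (F (u, v))) k x y.
Proof.
  revert F; induction k as [|k IH]; intros F [f [Hf Hk]] Hz.
  - split; [|exact I]; apply (continuity_2d_Re F x y (f (x, y))), Hf, Hz.
  - simpl; repeat split.
    + apply (continuity_2d_Re F x y (f (x, y))), Hf, Hz.
    + eexists; apply is_derive_Re_x, Hf, Hz.
    + eexists; apply is_derive_Re_y, Hf, Hz.
    + apply (ex_diff_n_ext_loc (fun u v => Re (f (u, v)))); [|apply IH; assumption].
      eapply locally_2d_impl; [|apply (disk_locally_2d x y Hz)].
      apply locally_2d_forall; intros u v Huv; symmetry.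
      apply is_derive_unique, is_derive_Re_x, Hf, Huv.
    + apply (ex_diff_n_ext_loc (fun u v => Re (Ci * f (u, v))%C)).
      * eapply locally_2d_impl; [|apply (disk_locally_2d x y Hz)].
        apply locally_2d_forall; intros u v Huv; symmetry.
        apply is_derive_unique, is_derive_Re_y, Hf, Huv.
      * apply (IH (fun w => Ci * f w)%C); [|exact Hz].
        apply csmooth_mult; [apply csmooth_const | exact Hk].
Qed.

(** Coordinates that are imaginary parts enter as [Re (- Ci * P)], so that all three are treated
    alike. *)
Definition re_map (P1 P2 P3 : C -> C) (z : C) : vec3 :=
  (Re (P1 z), Re (P2 z), Re (P3 z)).

Lemma vec_x_re_map (P1 P2 P3 p1 p2 p3 : C -> C) (z : C) :
  Cder P1 z (p1 z) -> Cder P2 z (p2 z) -> Cder P3 z (p3 z) ->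
  vec_x (re_map P1 P2 P3) z = (Re (p1 z), Re (p2 z), Re (p3 z)).
Proof.
  intros H1 H2 H3; unfold vec_x; f_equal; [f_equal|].
  - exact (Dx_Re P1 z _ H1).
  - exact (Dx_Re P2 z _ H2).
  - exact (Dx_Re P3 z _ H3).
Qed.

Lemma vec_y_re_map (P1 P2 P3 p1 p2 p3 : C -> C) (z : C) :
  Cder P1 z (p1 z) -> Cder P2 z (p2 z) -> Cder P3 z (p3 z) ->
  vec_y (re_map P1 P2 P3) z = (Re (Ci * p1 z)%C, Re (Ci * p2 z)%C, Re (Ci * p3 z)%C).
Proof.
  intros H1 H2 H3; unfold vec_y; f_equal; [f_equal|].
  - exact (Dy_Re P1 z _ H1).
  - exact (Dy_Re P2 z _ H2).
  - exact (Dy_Re P3 z _ H3).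
Qed.

Lemma Laplacian_Re (u : C -> R) (F f : C -> C) (z : C) :
  (forall w, disk w -> Cder F w (f w)) -> csmooth 2 f ->
  (forall w, u w = Re (F w)) -> disk z ->
  Dx (Dx u) z + Dy (Dy u) z = 0.
Proof.
  intros HF [f' [Hf _]] Hu Hz.
  assert (E : forall w, disk w -> Dx u w = Re (f w) /\ Dy u w = Re (Ci * f w)%C).
  { intros w Hw; split.
    - rewrite (Dx_ext_disk u (fun w => Re (F w))) by auto; apply Dx_Re; auto.
    - rewrite (Dy_ext_disk u (fun w => Re (F w))) by auto; apply Dy_Re; auto. }
  rewrite (Dx_ext_disk (Dx u) (fun w => Re (f w))) by (auto; apply E).
  rewrite (Dy_ext_disk (Dy u) (fun w => Re (Ci * f w)%C)) by (auto; apply E).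
  rewrite (Dx_Re f z (f' z)) by auto.
  rewrite (Dy_Re (fun w => Ci * f w)%C z (0 * f z + Ci * f' z)%C).
  2:{ apply (Cder_mult (fun _ => Ci) f); [apply Cder_const | auto]. }
  destruct (f' z) as [a b]; simpl; ring.
Qed.

(** Writing [pj = aj + i bj], the tangent vectors are [(aj)] and [(- bj)]. The real part of the sum
    of squares is then [E - G], and its imaginary part is [- 2 F]. *)
Lemma weierstrass_isothermal (P1 P2 P3 p1 p2 p3 : C -> C)
  (HP1 : forall z, disk z -> Cder P1 z (p1 z))
  (HP2 : forall z, disk z -> Cder P2 z (p2 z))
  (HP3 : forall z, disk z -> Cder P3 z (p3 z))
  (Hnull : forall z, disk z -> (p1 z ^ 2 + p2 z ^ 2 + p3 z ^ 2 = 0)%C) :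
  isothermal (re_map P1 P2 P3).
Proof.
  intros z Hz; unfold ffE, ffF, ffG.
  rewrite (vec_x_re_map P1 P2 P3 p1 p2 p3), (vec_y_re_map P1 P2 P3 p1 p2 p3) by auto.
  pose proof (Hnull z Hz) as H.
  destruct (p1 z) as [a1 b1], (p2 z) as [a2 b2], (p3 z) as [a3 b3].
  unfold dot, crd1, crd2, crd3; simpl.
  injection H; simpl; intros Hi Hr; split; lra.
Qed.

(** Since [E = G] and [F = 0], the numerator of the mean curvature is [(L + N) * E], and [L + N] is
    the Laplacian of the map paired with the unit normal. *)
Lemma weierstrass_minimal (P1 P2 P3 p1 p2 p3 : C -> C)
  (HP1 : forall z, disk z -> Cder P1 z (p1 z))
  (HP2 : forall z, disk z -> Cder P2 z (p2 z))
  (HP3 : forall z, disk z -> Cder P3 z (p3 z))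
  (Hp1 : csmooth 2 p1) (Hp2 : csmooth 2 p2) (Hp3 : csmooth 2 p3)
  (Hnull : forall z, disk z -> (p1 z ^ 2 + p2 z ^ 2 + p3 z ^ 2 = 0)%C)
  (Hjac : forall z, disk z ->
     jacobian (fun w => Re (P1 w)) (fun w => Re (P2 w)) z <> 0) :
  minimal_surface (re_map P1 P2 P3).
Proof.
  assert (HC2 : forall F f, (forall w, disk w -> Cder F w (f w)) -> csmooth 2 f ->
            C2_on_disk (fun z => Re (F z))).
  { intros F f HF Hf [x y] Hz; apply ex_diff_n_Re; [|exact Hz].
    exists f; split; assumption. }
  split; [split; [|split; [|split]] |].
  - apply (HC2 P1 p1); assumption.
  - apply (HC2 P2 p2); assumption.
  - apply (HC2 P3 p3); assumption.
  - intros z Hz E; apply (Hjac z Hz).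
    (* The third coordinate of the cross product is the Jacobian of the first two coordinates. *)
    unfold jacobian; rewrite (Rmult_comm (Dy _ z)); exact (f_equal crd3 E).
  - intros z Hz.
    destruct (weierstrass_isothermal P1 P2 P3 p1 p2 p3 HP1 HP2 HP3 Hnull z Hz)
      as [HE HF].
    set (X := re_map P1 P2 P3) in *.
    unfold mean_curvature; rewrite HF, <- HE.
    assert (HLN : sfL X z + sfN X z = 0).
    { unfold sfL, sfN.
      pose proof (Laplacian_Re (fun w => crd1 (X w)) P1 p1 z HP1 Hp1
                    (fun w => eq_refl) Hz) as L1.
      pose proof (Laplacian_Re (fun w => crd2 (X w)) P2 p2 z HP2 Hp2
                    (fun w => eq_refl) Hz) as L2.
      pose proof (Laplacian_Re (fun w => crd3 (X w)) P3 p3 z HP3 Hp3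
                    (fun w => eq_refl) Hz) as L3.
      set (N := unit_normal X z).
      transitivity
        ((Dx (Dx (fun w => crd1 (X w))) z + Dy (Dy (fun w => crd1 (X w))) z) * crd1 N
       + (Dx (Dx (fun w => crd2 (X w))) z + Dy (Dy (fun w => crd2 (X w))) z) * crd2 N
       + (Dx (Dx (fun w => crd3 (X w))) z + Dy (Dy (fun w => crd3 (X w))) z) * crd3 N).
      - unfold dot, vec_x, vec_y, crd1, crd2, crd3; simpl.
        unfold Dx, Dy; simpl; ring.
      - rewrite L1, L2, L3; ring. }
    replace (sfL X z * ffE X z - 2 * sfM X z * 0 + sfN X z * ffE X z)
      with ((sfL X z + sfN X z) * ffE X z) by ring.
    rewrite HLN; unfold Rdiv; ring.
Qed.

(** * Lagrange interpolation at the roots of unity *)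

Fixpoint Csum (f : nat -> C) (n : nat) : C :=
  match n with
  | O => 0%C
  | S m => (Csum f m + f m)%C
  end.

Lemma Csum_ext (f g : nat -> C) (n : nat) :
  (forall k, (k < n)%nat -> f k = g k) -> Csum f n = Csum g n.
Proof.
  induction n as [|n IH]; intros H; simpl; [reflexivity|].
  rewrite IH, H by (intros; try apply H; lia); reflexivity.
Qed.

Lemma Csum_plus (f g : nat -> C) (n : nat) :
  Csum (fun k => f k + g k)%C n = (Csum f n + Csum g n)%C.
Proof. induction n as [|n IH]; simpl; [|rewrite IH]; ring. Qed.

Lemma Csum_scal (c : C) (f : nat -> C) (n : nat) :
  Csum (fun k => c * f k)%C n = (c * Csum f n)%C.
Proof. induction n as [|n IH]; simpl; [|rewrite IH]; ring. Qed.

Lemma Csum_0 (n : nat) : Csum (fun _ => 0%C) n = 0%C.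
Proof. induction n as [|n IH]; simpl; [|rewrite IH]; ring. Qed.

Lemma Csum_exchange (f : nat -> nat -> C) (n m : nat) :
  Csum (fun i => Csum (f i) m) n = Csum (fun j => Csum (fun i => f i j) n) m.
Proof.
  induction n as [|n IH]; simpl.
  - rewrite Csum_0; reflexivity.
  - rewrite IH, <- Csum_plus; reflexivity.
Qed.

Lemma Csum_single (f : nat -> C) (n j : nat) :
  (j < n)%nat -> (forall i, (i < n)%nat -> i <> j -> f i = 0%C) ->
  Csum f n = f j.
Proof.
  induction n as [|n IH]; intros Hj H; [lia|]; simpl.
  destruct (Nat.eq_dec j n) as [->|Hn].
  - rewrite (Csum_ext f (fun _ => 0%C)) by (intros; apply H; lia).
    rewrite Csum_0; ring.
  - rewrite IH, (H n) by (intros; try apply H; lia); ring.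
Qed.

Lemma Csum_S_l (f : nat -> C) (n : nat) :
  Csum f (S n) = (f O + Csum (fun k => f (S k)) n)%C.
Proof.
  induction n as [|n IH]; [simpl; ring|].
  change (Csum f (S (S n))) with (Csum f (S n) + f (S n))%C.
  rewrite IH; simpl; ring.
Qed.

Lemma Csum_add (f : nat -> C) (m n : nat) :
  Csum f (m + n) = (Csum f m + Csum (fun k => f (m + k)%nat) n)%C.
Proof.
  induction n as [|n IH].
  - rewrite Nat.add_0_r; simpl; ring.
  - rewrite Nat.add_succ_r; simpl; rewrite IH; ring.
Qed.

Lemma Csum_rev (f : nat -> C) (n : nat) :
  Csum f n = Csum (fun k => f (n - 1 - k)%nat) n.
Proof.
  induction n as [|n IH]; [reflexivity|].
  rewrite (Csum_S_l (fun k => f (S n - 1 - k)%nat)); cbn [Csum].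
  rewrite IH, Cplus_comm; apply (f_equal2 Cplus); [f_equal; lia|].
  apply Csum_ext; intros k Hk; f_equal; lia.
Qed.

(** The factor [1 + (-1)^k] kills the odd indices. It lets an alternating sum over the [2m]-th roots
    be traded for plain sums over the [m]-th and [2m]-th roots. *)
Lemma Csum_double (f : nat -> C) (m : nat) :
  Csum (fun k => RtoC (1 + (-1) ^ k) * f k)%C (2 * m) =
  (2 * Csum (fun k => f (2 * k)%nat) m)%C.
Proof.
  induction m as [|m IH]; [simpl; ring|].
  replace (2 * S m)%nat with (S (S (2 * m))) by lia.
  cbn [Csum]; rewrite IH.
  replace ((-1) ^ S (2 * m)) with (-1) by (rewrite pow_1_odd; reflexivity).
  rewrite pow_1_even.
  replace (RtoC (1 + 1)) with (RtoC 2) by (f_equal; ring).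
  replace (RtoC (1 + -1)) with (RtoC 0) by (f_equal; ring).
  ring.
Qed.

(** Reversing the upper half of the range pairs [k] with [n - k]; the fixed points of this
    reflection, [0] and for even [n] also [S K = n / 2], must contribute nothing. *)
Lemma Csum_paired (f : nat -> C) (n K : nat) :
  f O = 0%C ->
  (n = (2 * K + 1)%nat \/ (n = (2 * K + 2)%nat /\ f (S K) = 0%C)) ->
  Csum f n = Csum (fun k => f (S k) + f (n - S k)%nat)%C K.
Proof.
  intros H0 Hn; rewrite Csum_plus.
  destruct Hn as [-> | [-> HK]].
  - replace (2 * K + 1)%nat with (S (K + K)) by lia.
    rewrite Csum_S_l, H0, Csum_add, Cplus_0_l; f_equal.
    rewrite Csum_rev; apply Csum_ext; intros k Hk; f_equal; lia.
  - replace (2 * K + 2)%nat with (S (S K + K)) by lia.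
    rewrite Csum_S_l, H0, Csum_add, Cplus_0_l; cbn [Csum]; rewrite HK.
    rewrite Cplus_0_r; f_equal.
    rewrite Csum_rev; apply Csum_ext; intros k Hk; f_equal; lia.
Qed.

Lemma Csum_geometric (x : C) (n : nat) :
  ((1 - x) * Csum (fun i => x ^ i) n = 1 - x ^ n)%C.
Proof.
  induction n as [|n IH]; simpl; [ring|].
  replace ((1 - x) * (Csum (fun i => x ^ i) n + x ^ n))%C
    with ((1 - x) * Csum (fun i => x ^ i) n + (1 - x) * x ^ n)%C by ring.
  rewrite IH; ring.
Qed.

(** * Roots of unity, half angles and orthogonality *)

Definition unit_root (n k : nat) : C := Cexp (Ci * RtoC (2 * INR k * PI / INR n)).

Lemma Cexp_opp (a : C) : Cexp (- a) = (/ Cexp a)%C.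
Proof.
  replace (- a)%C with (0 - a)%C by ring.
  rewrite Cexp_minus, Cexp_0; unfold Cdiv; ring.
Qed.

Lemma Cmod_Cexp_Ci (t : R) : Cmod (Cexp (Ci * RtoC t)) = 1.
Proof.
  rewrite Cmod_Cexp; replace (Re (Ci * RtoC t)%C) with 0 by (simpl; ring).
  apply exp_0.
Qed.

Lemma Cexp_Ci (t : R) : Cexp (Ci * RtoC t) = (cos t, sin t).
Proof.
  unfold Cexp; replace (Re (Ci * RtoC t)%C) with 0 by (simpl; ring).
  replace (Im (Ci * RtoC t)%C) with t by (simpl; ring).
  rewrite exp_0, !Rmult_1_l; reflexivity.
Qed.

Lemma unit_root_neq_0 (n k : nat) : unit_root n k <> 0%C.
Proof. apply Cexp_neq_0. Qed.

Lemma Cmod_unit_root (n k : nat) : Cmod (unit_root n k) = 1.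
Proof. apply Cmod_Cexp_Ci. Qed.

Lemma Cmod_inv_unit_root (n k : nat) : Cmod (/ unit_root n k) = 1.
Proof.
  rewrite Cmod_inv by apply unit_root_neq_0.
  rewrite Cmod_unit_root; apply Rinv_1.
Qed.

Lemma unit_root_0 (n : nat) : unit_root n 0 = 1%C.
Proof.
  unfold unit_root; replace (2 * INR 0 * PI / INR n) with 0
    by (simpl; unfold Rdiv; ring).
  rewrite Cmult_0_r; apply Cexp_0.
Qed.

Lemma unit_root_add (n j k : nat) :
  unit_root n (j + k) = (unit_root n j * unit_root n k)%C.
Proof.
  unfold unit_root; rewrite <- Cexp_plus; f_equal.
  rewrite <- Cmult_plus_distr_l, <- RtoC_plus, plus_INR; do 2 f_equal.
  unfold Rdiv; ring.
Qed.

Lemma unit_root_pow (n k j : nat) : (unit_root n k ^ j)%C = unit_root n (k * j).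
Proof.
  induction j as [|j IH].
  - rewrite Nat.mul_0_r, unit_root_0; reflexivity.
  - rewrite Nat.mul_succ_r, Nat.add_comm, unit_root_add, <- IH; reflexivity.
Qed.

Lemma unit_root_n (n : nat) : (1 <= n)%nat -> unit_root n n = 1%C.
Proof.
  intros Hn; unfold unit_root.
  replace (2 * INR n * PI / INR n) with (2 * PI)
    by (field; apply not_0_INR; lia).
  rewrite Cexp_Ci, cos_2PI, sin_2PI; reflexivity.
Qed.

Lemma unit_root_pow_n (n k : nat) : (1 <= n)%nat -> (unit_root n k ^ n)%C = 1%C.
Proof.
  intros Hn; rewrite unit_root_pow, Nat.mul_comm, <- unit_root_pow.
  rewrite unit_root_n by exact Hn; apply Cpow_1_l.
Qed.

Lemma unit_root_compl (n k : nat) :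
  (1 <= n)%nat -> (k <= n)%nat -> unit_root n (n - k) = (/ unit_root n k)%C.
Proof.
  intros Hn Hk.
  pose proof (unit_root_neq_0 n k) as H0.
  assert (H : (unit_root n (n - k) * unit_root n k = 1)%C).
  { rewrite <- unit_root_add, Nat.sub_add by exact Hk; apply unit_root_n, Hn. }
  replace (unit_root n (n - k))
    with (unit_root n (n - k) * unit_root n k * / unit_root n k)%C
    by (field; exact H0).
  rewrite H; ring.
Qed.

Lemma half_angle_range (n k : nat) :
  (0 < k < n)%nat -> 0 < INR k * PI / INR n < PI.
Proof.
  intros [H0 H1].
  apply lt_INR in H0; apply lt_INR in H1; simpl in H0.
  pose proof PI_RGT_0.
  split.
  - apply Rdiv_lt_0_compat; nra.
  - apply Rmult_lt_reg_r with (INR n); [lra|].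
    unfold Rdiv; rewrite Rmult_assoc, Rinv_l by lra; nra.
Qed.

Lemma sin_half_angle_pos (n k : nat) :
  (0 < k < n)%nat -> 0 < sin (INR k * PI / INR n).
Proof. intros H; apply half_angle_range in H; apply sin_gt_0; apply H. Qed.

(** A square root of [unit_root n k]; pulling it out of [1 + w] and [1 - w] leaves a real,
    respectively purely imaginary, factor. *)
Definition half_root (n k : nat) : C := Cexp (Ci * RtoC (INR k * PI / INR n)).

Lemma unit_root_half (n k : nat) :
  unit_root n k = (half_root n k * half_root n k)%C.
Proof.
  unfold unit_root, half_root; rewrite <- Cexp_plus; f_equal.
  rewrite <- Cmult_plus_distr_l, <- RtoC_plus; do 2 f_equal.
  unfold Rdiv; ring.
Qed.

Lemma half_root_cos_sin (n k : nat) :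
  half_root n k =
  (RtoC (cos (INR k * PI / INR n)) + Ci * RtoC (sin (INR k * PI / INR n)))%C.
Proof.
  unfold half_root; rewrite Cexp_Ci.
  unfold RtoC, Ci, Cplus, Cmult; simpl; f_equal; ring.
Qed.

Lemma Ci_sqr : (Ci * Ci = - (1))%C.
Proof. unfold Ci, Cmult, Copp, RtoC; simpl; f_equal; ring. Qed.

Lemma cos_sin_one (t : R) :
  (RtoC (cos t) * RtoC (cos t) + RtoC (sin t) * RtoC (sin t) = 1)%C.
Proof.
  rewrite <- !RtoC_mult, <- RtoC_plus; f_equal.
  pose proof (sin2_cos2 t) as H; unfold Rsqr in H; lra.
Qed.

Lemma one_plus_unit_root (n k : nat) :
  (1 + unit_root n k =
   2 * RtoC (cos (INR k * PI / INR n)) * half_root n k)%C.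
Proof.
  rewrite unit_root_half, half_root_cos_sin.
  rewrite <- (cos_sin_one (INR k * PI / INR n)).
  set (c := RtoC (cos _)); set (s := RtoC (sin _)).
  replace ((c + Ci * s) * (c + Ci * s))%C
    with (c * c + 2 * Ci * c * s + Ci * Ci * (s * s))%C by ring.
  rewrite Ci_sqr; ring.
Qed.

Lemma one_minus_unit_root (n k : nat) :
  (1 - unit_root n k =
   - 2 * Ci * RtoC (sin (INR k * PI / INR n)) * half_root n k)%C.
Proof.
  rewrite unit_root_half, half_root_cos_sin.
  rewrite <- (cos_sin_one (INR k * PI / INR n)).
  set (c := RtoC (cos _)); set (s := RtoC (sin _)).
  replace ((c + Ci * s) * (c + Ci * s))%C
    with (c * c + 2 * Ci * c * s + Ci * Ci * (s * s))%C by ring.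
  replace (- 2 * Ci * s * (c + Ci * s))%C
    with (- 2 * Ci * s * c - 2 * (Ci * Ci) * (s * s))%C by ring.
  rewrite Ci_sqr; ring.
Qed.

Lemma unit_root_neq_1 (n k : nat) : (0 < k < n)%nat -> (1 - unit_root n k)%C <> 0%C.
Proof.
  intros Hk; rewrite one_minus_unit_root.
  pose proof (sin_half_angle_pos n k Hk).
  repeat apply Cmult_neq_0.
  - intros E; injection E; lra.
  - intros E; injection E; lra.
  - intros E; apply RtoC_inj in E; lra.
  - apply Cexp_neq_0.
Qed.

(** Powers and indices can be swapped, [w_k^j = w_j^k], so the sum is geometric with ratio
    [r = w_j / w_i], where [r^n = 1] and [r] differs from [1]. *)
Lemma unit_root_orthogonal (n i j : nat) :
  (i < n)%nat -> (j < n)%nat -> i <> j ->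
  Csum (fun k => unit_root n k ^ j / unit_root n k ^ i)%C n = 0%C.
Proof.
  intros Hi Hj Hij.
  set (r := (unit_root n j / unit_root n i)%C).
  pose proof (unit_root_neq_0 n i) as Ni.
  rewrite (Csum_ext _ (fun k => r ^ k)%C).
  2:{ intros k _; rewrite !unit_root_pow, (Nat.mul_comm k j), (Nat.mul_comm k i).
      rewrite <- !unit_root_pow.
      unfold r, Cdiv; rewrite Cpow_mult_l, Cpow_inv by exact Ni; reflexivity. }
  assert (Hr : (1 - r)%C <> 0%C).
  { assert (E : (1 - r = (unit_root n i - unit_root n j) / unit_root n i)%C)
      by (unfold r; field; exact Ni).
    rewrite E; apply Cmult_neq_0.
    2:{ intros H; apply (f_equal (Cmult (unit_root n i))) in H.
        rewrite Cinv_r, Cmult_0_r in H by exact Ni; apply C1_nz, H. }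
    destruct (Nat.lt_ge_cases i j) as [Hlt | Hge].
    - replace j with (i + (j - i))%nat by lia; rewrite unit_root_add.
      replace (unit_root n i - unit_root n i * unit_root n (j - i))%C
        with (unit_root n i * (1 - unit_root n (j - i)))%C by ring.
      apply Cmult_neq_0; [exact Ni | apply unit_root_neq_1; lia].
    - replace i with (j + (i - j))%nat by lia; rewrite unit_root_add.
      replace (unit_root n j * unit_root n (i - j) - unit_root n j)%C
        with (RtoC (- 1) * unit_root n j * (1 - unit_root n (i - j)))%C
        by ring.
      repeat apply Cmult_neq_0;
        [intros H; injection H; lra | apply unit_root_neq_0 |
         apply unit_root_neq_1; lia]. }
  assert (Hrn : (r ^ n = 1)%C).
  { unfold r, Cdiv; rewrite Cpow_mult_l, Cpow_inv by exact Ni.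
    rewrite !unit_root_pow_n by lia; field. }
  pose proof (Csum_geometric r n) as G; rewrite Hrn in G.
  replace (Csum (fun k => r ^ k)%C n)
    with (/ (1 - r) * ((1 - r) * Csum (fun k => r ^ k) n))%C by (field; exact Hr).
  rewrite G; ring.
Qed.

(** Because [w^n = 1], the quotient [(1 - z^n) / (1 - z / w)] is the geometric sum of [(z / w)^i].
    After exchanging the sums, orthogonality leaves only [i = j], counted [n] times. *)
Lemma lagrange_unit_roots (n : nat) (c : nat -> C) (z : C) :
  (1 <= n)%nat -> disk z ->
  ((1 - z ^ n) * Csum (fun k =>
     Csum (fun j => c j * unit_root n k ^ j) n / (1 - z * / unit_root n k)) n =
   RtoC (INR n) * Csum (fun j => c j * z ^ j) n)%C.
Proof.
  intros Hn Hz.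
  rewrite <- Csum_scal.
  rewrite (Csum_ext _ (fun k => Csum (fun j => Csum (fun i =>
      c j * z ^ i * (unit_root n k ^ j / unit_root n k ^ i)) n) n)%C).
  2:{ intros k _.
      pose proof (unit_root_neq_0 n k) as Nk.
      pose proof (one_minus_neq_0 _ (disk_mult_unit z _ (Cmod_inv_unit_root n k) Hz)) as Nz.
      pose proof (Csum_geometric (z * / unit_root n k) n) as G.
      rewrite Cpow_mult_l, Cpow_inv, unit_root_pow_n in G by assumption.
      replace (z ^ n * / RtoC 1)%C with (z ^ n)%C in G by field.
      rewrite <- G.
      set (S1 := Csum (fun i => (z * / unit_root n k) ^ i)%C n).
      set (S2 := Csum (fun j => c j * unit_root n k ^ j)%C n).
      transitivity (S1 * S2)%C.
      { revert Nz; set (x := (z * / unit_root n k)%C); intros Nz; field; exact Nz. }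
      unfold S2; rewrite <- Csum_scal; apply Csum_ext; intros j _.
      rewrite Cmult_comm; unfold S1; rewrite <- Csum_scal.
      apply Csum_ext; intros i _.
      rewrite Cpow_mult_l, Cpow_inv by exact Nk.
      unfold Cdiv; ring. }
  rewrite Csum_exchange.
  rewrite <- Csum_scal; apply Csum_ext; intros j Hj.
  rewrite Csum_exchange.
  rewrite (Csum_single _ n j Hj).
  - rewrite (Csum_ext _ (fun k => c j * z ^ j * 1)%C).
    2:{ intros k _; f_equal; field; apply Cpow_nz, unit_root_neq_0. }
    rewrite Csum_scal.
    replace (Csum (fun _ => RtoC 1) n) with (RtoC (INR n)); [ring|].
    clear; induction n as [|n IH]; [reflexivity|].
    rewrite S_INR, RtoC_plus, IH; reflexivity.
  - intros i Hi Hij; rewrite Csum_scal, unit_root_orthogonal by auto; ring.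
Qed.

(** * The partial fraction expansion *)

Definition weight (n k : nat) : R :=
  cot (INR k * PI / INR n) * csc (INR k * PI / INR n) ^ 2.

(* [cot 0 = 0] because [/ 0 = 0]; this lets sums start at [k = 0]. *)
Lemma weight_0 (n : nat) : weight n 0 = 0.
Proof.
  unfold weight, cot; replace (INR 0 * PI / INR n) with 0 by (simpl; unfold Rdiv; ring).
  rewrite sin_0; unfold Rdiv; rewrite Rinv_0; ring.
Qed.

Lemma weight_compl (n k : nat) :
  (1 <= n)%nat -> (k <= n)%nat -> weight n (n - k) = - weight n k.
Proof.
  intros Hn Hk; unfold weight, cot, csc.
  replace (INR (n - k) * PI / INR n) with (PI - INR k * PI / INR n).
  - rewrite sin_PI_x, cos_minus, cos_PI, sin_PI; unfold Rdiv; ring.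
  - rewrite minus_INR by exact Hk; field; apply not_0_INR; lia.
Qed.

Lemma weight_half (m : nat) : (1 <= m)%nat -> weight (2 * m) m = 0.
Proof.
  intros Hm; unfold weight, cot.
  replace (INR m * PI / INR (2 * m)) with (PI / 2)
    by (rewrite mult_INR; simpl; field; apply not_0_INR; lia).
  rewrite cos_PI2; unfold Rdiv; ring.
Qed.

Lemma weight_double (m k : nat) : (1 <= m)%nat -> weight (2 * m) (2 * k) = weight m k.
Proof.
  intros Hm; unfold weight.
  replace (INR (2 * k) * PI / INR (2 * m)) with (INR k * PI / INR m);
    [reflexivity|].
  rewrite !mult_INR; simpl; field; apply not_0_INR; lia.
Qed.

Lemma unit_root_double (m k : nat) :
  (1 <= m)%nat -> unit_root (2 * m) (2 * k) = unit_root m k.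
Proof.
  intros Hm; unfold unit_root; do 3 f_equal.
  rewrite !mult_INR; simpl; field; apply not_0_INR; lia.
Qed.

(** The left side is the value at the root of the polynomial to be interpolated. The half-angle
    forms of [1 + w] and [1 - w] turn it into [cos / sin^3], which is the weight. *)
Lemma residue_at_unit_root (n k : nat) :
  (0 < k < n)%nat ->
  (2 * (1 + unit_root n k) / (1 - unit_root n k) ^ 3 =
   - Ci / 2 * RtoC (weight n k) * / unit_root n k)%C.
Proof.
  intros Hk.
  pose proof (sin_half_angle_pos n k Hk) as Hs.
  rewrite one_plus_unit_root, one_minus_unit_root, unit_root_half.
  unfold weight, cot, csc.
  set (e := half_root n k).
  set (c := cos _); set (s := sin _) in *.
  assert (He : e <> 0%C) by apply Cexp_neq_0.
  assert (Hs0 : RtoC s <> 0%C) by (intros E; apply RtoC_inj in E; lra).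
  replace (RtoC (c / s * (/ s) ^ 2)) with (RtoC c / (RtoC s * RtoC s * RtoC s))%C.
  2:{ rewrite <- !RtoC_mult, <- RtoC_div by (apply Rgt_not_eq; repeat apply Rmult_lt_0_compat; exact Hs); f_equal; field; lra. }
  replace ((- 2 * Ci * RtoC s * e) ^ 3)%C
    with (- 8 * (Ci * Ci) * Ci * (RtoC s * RtoC s * RtoC s) * (e * e * e))%C by ring.
  rewrite Ci_sqr.
  assert (HCi : (/ Ci = - Ci)%C).
  { assert (H0 : Ci <> 0%C) by (intros E; injection E; lra).
    replace (- Ci)%C with (- (Ci * Ci) * / Ci)%C by (field; exact H0).
    rewrite Ci_sqr; ring. }
  assert (H0 : Ci <> 0%C) by (intros E; injection E; lra).
  rewrite <- HCi; field; auto.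
Qed.

(** For [N = n], the Taylor polynomial of degree 3 at [z = 1] of [2 (1 - z^2) / (1 - z^n)], in
    powers of [1 - z]; its cubic coefficient is zero, which is the vanishing of the residue. *)
Definition pole_part (N z : C) : C :=
  (4 / N + 2 * (N - 2) / N * (1 - z) + (N - 1) * (N - 2) / (3 * N) * (1 - z) ^ 2)%C.

(* The coefficient of [z ^ x] in
   [2 (1 + z) / (1 - z) ^ 3 - pole_part N z / (1 - z) ^ 4]. *)
Definition coef (N x : C) : C :=
  (2 * (x + 1) ^ 2
   - (4 / N * ((x + 1) * (x + 2) * (x + 3) / 6)
      + 2 * (N - 2) / N * ((x + 1) * (x + 2) / 2)
      + (N - 1) * (N - 2) / (3 * N) * (x + 1)))%C.

(* [(1 - z) ^ 4] times the power series with coefficients [coef N (x + j)]. *)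
Definition coef_tail (N x z : C) : C :=
  (coef N x + (coef N (x + 1) - 4 * coef N x) * z
   + (coef N (x + 2) - 4 * coef N (x + 1) + 6 * coef N x) * z ^ 2
   + (coef N (x + 3) - 4 * coef N (x + 2) + 6 * coef N (x + 1)
      - 4 * coef N x) * z ^ 3)%C.

Lemma RtoC_INR_S (n : nat) : RtoC (INR (S n)) = (RtoC (INR n) + 1)%C.
Proof. rewrite S_INR, RtoC_plus; reflexivity. Qed.

Lemma RtoC_INR_neq_0 (n : nat) : (1 <= n)%nat -> RtoC (INR n) <> 0%C.
Proof. intros Hn E; apply RtoC_inj in E; revert E; apply not_0_INR; lia. Qed.

Lemma RtoC_3_neq_0 : RtoC 3 <> 0%C.
Proof. intros E; apply RtoC_inj in E; lra. Qed.

(** The terms in [z^4] agree because [coef N] is cubic in [x], so its fourth difference vanishes;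
    the lower ones agree by construction. *)
Lemma coef_tail_step (N x z : C) :
  N <> 0%C ->
  (coef_tail N x z - (1 - z) ^ 4 * coef N x = z * coef_tail N (x + 1) z)%C.
Proof.
  intros HN; unfold coef_tail, coef; field; repeat split;
    try exact HN; intros E; apply RtoC_inj in E; lra.
Qed.

Lemma coef_partial_sum (N z : C) (M : nat) :
  N <> 0%C ->
  ((1 - z) ^ 4 * Csum (fun j => coef N (RtoC (INR j)) * z ^ j) M =
   coef_tail N 0 z - z ^ M * coef_tail N (RtoC (INR M)) z)%C.
Proof.
  intros HN; induction M as [|M IH].
  - simpl; ring.
  - cbn [Csum].
    replace ((1 - z) ^ 4 * (Csum (fun j => coef N (RtoC (INR j)) * z ^ j) M
               + coef N (RtoC (INR M)) * z ^ M))%C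
      with ((1 - z) ^ 4 * Csum (fun j => coef N (RtoC (INR j)) * z ^ j) M
               + (1 - z) ^ 4 * coef N (RtoC (INR M)) * z ^ M)%C by ring.
    rewrite IH, RtoC_INR_S, (Cpow_S z M).
    replace (z * z ^ M * coef_tail N (RtoC (INR M) + 1) z)%C
      with (z ^ M * (z * coef_tail N (RtoC (INR M) + 1) z))%C by ring.
    rewrite <- coef_tail_step by exact HN; ring.
Qed.

(** The telescoped remainder at [x = n] is exactly minus the pole part. This verifies the constants
    of [pole_part]: the right side is divisible by [(1 - z)^4]. *)
Lemma coef_polynomial (n : nat) (z : C) :
  (1 <= n)%nat ->
  ((1 - z) ^ 4 * Csum (fun j => coef (RtoC (INR n)) (RtoC (INR j)) * z ^ j) n =
   2 * (1 + z) * (1 - z) - (1 - z ^ n) * pole_part (RtoC (INR n)) z)%C.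
Proof.
  intros Hn; pose proof (RtoC_INR_neq_0 n Hn) as HN.
  rewrite coef_partial_sum by exact HN.
  assert (E0 : coef_tail (RtoC (INR n)) 0 z =
               (2 * (1 + z) * (1 - z) - pole_part (RtoC (INR n)) z)%C).
  { unfold coef_tail, coef, pole_part; field; repeat split;
      try exact HN; intros E; apply RtoC_inj in E; lra. }
  assert (En : coef_tail (RtoC (INR n)) (RtoC (INR n)) z =
               (- pole_part (RtoC (INR n)) z)%C).
  { unfold coef_tail, coef, pole_part; field; repeat split;
      try exact HN; intros E; apply RtoC_inj in E; lra. }
  rewrite E0, En; ring.
Qed.

(** At the root [1] the identity of [coef_polynomial] reads [0 = 0], so the value there is computed
    by summing the coefficients. For [M = n] the closed form is zero: no residue at [1]. *)
Lemma coef_sum (N : C) (M : nat) :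
  N <> 0%C ->
  Csum (fun j => coef N (RtoC (INR j))) M =
  (let x := RtoC (INR M) in
   2 * (x * (x + 1) * (2 * x + 1) / 6)
   - (4 / N * (x * (x + 1) * (x + 2) * (x + 3) / 24)
      + 2 * (N - 2) / N * (x * (x + 1) * (x + 2) / 6)
      + (N - 1) * (N - 2) / (3 * N) * (x * (x + 1) / 2)))%C.
Proof.
  intros HN; cbv zeta; induction M as [|M IH]; cbn [Csum].
  - simpl INR; field; repeat split;
      try exact HN; intros E; apply RtoC_inj in E; lra.
  - rewrite IH, RtoC_INR_S; unfold coef; field; repeat split;
      try exact HN; intros E; apply RtoC_inj in E; lra.
Qed.

Lemma coef_at_unit_root (n k : nat) :
  (k < n)%nat ->
  Csum (fun j => coef (RtoC (INR n)) (RtoC (INR j)) * unit_root n k ^ j)%C n =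
  (- Ci / 2 * RtoC (weight n k) * / unit_root n k)%C.
Proof.
  intros Hk; destruct k as [|k].
  - assert (HN : RtoC (INR n) <> 0%C) by (apply RtoC_INR_neq_0; lia).
    rewrite weight_0, (Csum_ext _ (fun j => coef (RtoC (INR n)) (RtoC (INR j)))).
    + rewrite coef_sum by exact HN; cbv zeta.
      rewrite Cmult_0_r, Cmult_0_l.
      field; repeat split; try exact HN; intros E; apply RtoC_inj in E; lra.
    + intros j _; rewrite unit_root_0, Cpow_1_l; ring.
  - rewrite <- residue_at_unit_root by lia.
    pose proof (coef_polynomial n (unit_root n (S k)) ltac:(lia)) as H.
    pose proof (unit_root_neq_1 n (S k) ltac:(lia)) as H1.
    rewrite unit_root_pow_n in H by lia.
    set (w := unit_root n (S k)) in *.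
    set (P := Csum _ n) in *.
    replace P with (((1 - w) ^ 4 * P) / (1 - w) ^ 4)%C by (field; exact H1).
    rewrite H; field; exact H1.
Qed.

(** The derivative of [weight n k * log (1 - z / w^k)], that is, the weight times
    [1 / (z - w^k)]. *)
Definition log_term (n k : nat) (z : C) : C :=
  (RtoC (weight n k) * (- / unit_root n k / (1 - z * / unit_root n k)))%C.

Lemma disk_pow_neq_1 (n : nat) (z : C) :
  (1 <= n)%nat -> disk z -> (1 - z ^ n)%C <> 0%C.
Proof.
  intros Hn Hz; apply one_minus_neq_0; unfold disk in *; rewrite Cmod_pow.
  pose proof (Cmod_ge_0 z) as H0.
  destruct n as [|n]; [lia|]; simpl.
  apply Rle_lt_trans with (Cmod z * 1); [|lra].
  apply Rmult_le_compat_l; [exact H0|].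
  rewrite <- (pow1 n); apply pow_incr; lra.
Qed.

Lemma partial_fractions (n : nat) (z : C) :
  (1 <= n)%nat -> disk z ->
  (2 * (1 + z) / ((1 - z) ^ 3 * (1 - z ^ n)) =
   pole_part (RtoC (INR n)) z / (1 - z) ^ 4
   + Ci / (2 * RtoC (INR n)) * Csum (fun k => log_term n k z) n)%C.
Proof.
  intros Hn Hz.
  pose proof (RtoC_INR_neq_0 n Hn) as HN.
  pose proof (one_minus_neq_0 z Hz) as H1.
  pose proof (disk_pow_neq_1 n z Hn Hz) as H2.
  pose proof (coef_polynomial n z Hn) as HP.
  pose proof (lagrange_unit_roots n (fun j => coef (RtoC (INR n)) (RtoC (INR j))) z Hn Hz)
    as HL.
  rewrite (Csum_ext _ (fun k => - (Ci) / 2 * - 1 * log_term n k z)%C) in HL.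
  2:{ intros k Hk; rewrite coef_at_unit_root by exact Hk.
      unfold log_term, Cdiv; ring. }
  rewrite Csum_scal in HL.
  set (P := Csum (fun j => _ * z ^ j)%C n) in *.
  set (L := Csum (fun k => log_term n k z) n) in *.
  set (N := RtoC (INR n)) in *.
  set (B := pole_part N z) in *.
  replace (2 * (1 + z))%C
    with (((1 - z) ^ 4 * P + (1 - z ^ n) * B) / (1 - z))%C
    by (rewrite HP; field; exact H1).
  replace P with ((1 - z ^ n) * (- Ci / 2 * - 1 * L) / N)%C
    by (rewrite HL; field; exact HN).
  revert H2; set (y := (z ^ n)%C); intros H2.
  field; auto.
Qed.

(** * Derivatives of the closed forms *)

Lemma Cder_Csum (f g : nat -> C -> C) (n : nat) (z : C) :
  (forall k, (k < n)%nat -> Cder (f k) z (g k z)) ->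
  Cder (fun w => Csum (fun k => f k w) n) z (Csum (fun k => g k z) n).
Proof.
  induction n as [|n IH]; intros H; cbn [Csum]; [apply Cder_const|].
  apply Cder_plus; [apply IH; intros; apply H; lia | apply H; lia].
Qed.

Lemma sum_n_m_Csum (f : nat -> C) (K : nat) :
  @sum_n_m C_AbelianMonoid f 1 K = Csum (fun k => f (S k)) K.
Proof.
  induction K as [|K IH].
  - apply (@sum_n_m_zero C_AbelianMonoid); lia.
  - rewrite sum_n_Sm, IH by lia; reflexivity.
Qed.

Lemma log_term_0 (n : nat) (z : C) : log_term n 0 z = 0%C.
Proof. unfold log_term; rewrite weight_0; ring. Qed.

Lemma log_term_pair (n k : nat) (z : C) :
  (1 <= n)%nat -> (k <= n)%nat ->
  (log_term n k z + log_term n (n - k) z =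
   RtoC (weight n k) *
   (- / unit_root n k / (1 - z * / unit_root n k)
    + unit_root n k / (1 - z * unit_root n k)))%C.
Proof.
  intros Hn Hk; unfold log_term.
  rewrite weight_compl, unit_root_compl by assumption.
  replace (/ / unit_root n k)%C with (unit_root n k)
    by (field; apply unit_root_neq_0).
  rewrite RtoC_opp; unfold Cdiv; ring.
Qed.

Lemma log_sum_0 (n K : nat) (s : nat -> R) : log_sum n K s 0 = 0%C.
Proof.
  unfold log_sum; rewrite sum_n_m_Csum.
  rewrite (Csum_ext _ (fun _ => 0%C)); [rewrite Csum_0; ring|].
  intros k _; rewrite log_branch_0; [ring | | apply Cmod_Cexp_Ci].
  rewrite Cexp_opp; apply Cmod_inv_unit_root.
Qed.

(** The weight is odd and [s] is even under [k -> n - k], so the fractions at [w^k] and [w^(n-k)]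
    together form the derivative of a single logarithm of a quotient. *)
Lemma Cder_log_sum (n K : nat) (s : nat -> R) (z : C) :
  (1 <= n)%nat -> (n = 2 * K + 1 \/ n = 2 * K + 2)%nat ->
  (forall k, (k <= n)%nat -> s (n - k)%nat = s k) -> disk z ->
  Cder (log_sum n K s) z
    (Ci / (2 * RtoC (INR n)) * Csum (fun k => RtoC (s k) * log_term n k z) n)%C.
Proof.
  intros Hn HK Hs Hz.
  rewrite (Csum_paired _ n K).
  2:{ rewrite log_term_0; ring. }
  2:{ destruct HK as [HK | HK]; [left; exact HK | right; split; [exact HK|]].
      unfold log_term; replace n with (2 * S K)%nat by lia.
      rewrite weight_half by lia; ring. }
  unfold log_sum.
  apply (Cder_ext (fun w => Ci / RtoC (2 * INR n) * Csum (fun k =>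
     RtoC (s (S k) * weight n (S k)) * log_branch
       (fun w => (1 - w * Cexp (- (Ci * RtoC (2 * INR (S k) * PI / INR n)))) /
                 (1 - w * Cexp (Ci * RtoC (2 * INR (S k) * PI / INR n)))) w) K)%C
     _ _
     (0 * Csum (fun k =>
     RtoC (s (S k) * weight n (S k)) * log_branch
       (fun w => (1 - w * Cexp (- (Ci * RtoC (2 * INR (S k) * PI / INR n)))) /
                 (1 - w * Cexp (Ci * RtoC (2 * INR (S k) * PI / INR n)))) z) K
      + Ci / RtoC (2 * INR n) * Csum (fun k => RtoC (s (S k)) * log_term n (S k) z +
        RtoC (s (n - S k)%nat) * log_term n (n - S k) z) K)%C).
  - intros w; rewrite sum_n_m_Csum; reflexivity.
  - rewrite RtoC_mult; ring.
  - apply (Cder_mult (fun _ => Ci / RtoC (2 * INR n))%C); [apply Cder_const|].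
    apply (Cder_Csum
      (fun k w => RtoC (s (S k) * weight n (S k)) * log_branch
       (fun w => (1 - w * Cexp (- (Ci * RtoC (2 * INR (S k) * PI / INR n)))) /
                 (1 - w * Cexp (Ci * RtoC (2 * INR (S k) * PI / INR n)))) w)%C
      (fun k w => RtoC (s (S k)) * log_term n (S k) w +
        RtoC (s (n - S k)%nat) * log_term n (n - S k) w)%C).
    intros k Hk.
    rewrite Hs by lia.
    rewrite <- Cmult_plus_distr_l, log_term_pair by lia.
    set (L := log_branch _).
    assert (HL : Cder L z (- / unit_root n (S k) / (1 - z * / unit_root n (S k))
                + unit_root n (S k) / (1 - z * unit_root n (S k)))%C).
    { unfold L; rewrite Cexp_opp.
      apply Cder_log_branch; [apply Cmod_inv_unit_root | apply Cmod_unit_root | exact Hz]. }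
    eapply Cder_ext; [| | apply (Cder_mult _ L _ 0 _
                          (Cder_const (RtoC (s (S k) * weight n (S k))) z) HL)].
    + reflexivity.
    + rewrite RtoC_mult; ring.
Qed.

(** The three functions are [(1 - z)^(-j) - 1] for [j = 1, 2, 3]: the primitives of
    [j / (1 - z)^(j + 1)] that vanish at 0. *)
Definition polar_primitive (A B D z : C) : C :=
  (A * (z / (1 - z)) + B * (z * (2 - z) / (1 - z) ^ 2)
   + D * (z * (z ^ 2 - 3 * z + 3) / (1 - z) ^ 3))%C.

Lemma Cder_inv_one_minus (z : C) :
  disk z -> Cder (fun w => / (1 - w))%C z (/ (1 - z) * / (1 - z))%C.
Proof.
  intros Hz; pose proof (one_minus_neq_0 z Hz) as H0.
  eapply Cder_ext; [| | apply (Cder_inv (fun w => 1 - w)%C z (0 - 1));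
    [exact H0 | apply Cder_minus; [apply Cder_const | apply Cder_id]]].
  - reflexivity.
  - field; exact H0.
Qed.

Lemma Cder_polar_primitive (A B D z : C) :
  disk z ->
  Cder (polar_primitive A B D) z
    (A / (1 - z) ^ 2 + 2 * B / (1 - z) ^ 3 + 3 * D / (1 - z) ^ 4)%C.
Proof.
  intros Hz; pose proof (one_minus_neq_0 z Hz) as H0.
  pose proof (Cder_inv_one_minus z Hz) as He.
  set (e := (fun w => / (1 - w))%C) in *.
  apply (Cder_ext_disk (fun w => A * e w + B * (e w * e w)
           + D * (e w * (e w * e w)) - (A + B + D))%C); [exact Hz | |].
  - intros w Hw; pose proof (one_minus_neq_0 w Hw) as Hw0.
    unfold e, polar_primitive; field; exact Hw0.
  - pose proof (Cder_mult _ _ _ _ _ He He) as He2.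
    pose proof (Cder_mult _ _ _ _ _ He He2) as He3.
    eapply Cder_ext; [reflexivity | |
      apply Cder_minus; [| apply Cder_const];
      apply Cder_plus; [apply Cder_plus |];
      apply (Cder_mult (fun _ => _));
      [apply Cder_const | exact He | apply Cder_const | exact He2
       | apply Cder_const | exact He3]].
    unfold e; field; exact H0.
Qed.

Lemma Cder_koebe (z : C) :
  disk z -> Cder (fun w => w / (1 - w) ^ 2)%C z ((1 + z) / (1 - z) ^ 3)%C.
Proof.
  intros Hz; pose proof (one_minus_neq_0 z Hz) as H0.
  pose proof (Cder_inv_one_minus z Hz) as He.
  set (e := (fun w => / (1 - w))%C) in *.
  apply (Cder_ext_disk (fun w => e w * e w - e w)%C); [exact Hz | |].
  - intros w Hw; pose proof (one_minus_neq_0 w Hw) as Hw0.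
    unfold e; field; exact Hw0.
  - eapply Cder_ext; [reflexivity | |
      apply (Cder_minus _ _ _ _ _ (Cder_mult _ _ _ _ _ He He) He)].
    unfold e; field; exact H0.
Qed.

Definition h_derivative (n : nat) (z : C) : C :=
  ((1 + z) / ((1 - z) ^ 3 * (1 - z ^ n)))%C.

Lemma csmooth_h_derivative (k n : nat) : (1 <= n)%nat -> csmooth k (h_derivative n).
Proof.
  intros Hn; unfold h_derivative, Cdiv.
  assert (H1 : forall m, csmooth k (fun z => 1 - z ^ m)%C).
  { intros m; apply csmooth_plus; [apply csmooth_const|].
    apply csmooth_opp, csmooth_pow, csmooth_id. }
  apply csmooth_mult.
  - apply csmooth_plus; [apply csmooth_const | apply csmooth_id].
  - apply (csmooth_inv k (fun z => (1 - z) ^ 3 * (1 - z ^ n))%C).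
    + intros z Hz; apply Cmult_neq_0; [apply Cpow_nz, one_minus_neq_0, Hz|].
      apply disk_pow_neq_1; assumption.
    + apply csmooth_mult; [apply (csmooth_pow k 3 (fun z => 1 - z)%C) | apply H1].
      apply csmooth_plus; [apply csmooth_const | apply csmooth_opp, csmooth_id].
Qed.

(** The holomorphic function whose real part is [u_formula], in the same syntactic form so that the
    two are convertible; likewise [F_primitive] with the imaginary part. *)
Definition u_primitive (n K : nat) (z : C) : C :=
  (- z / (1 - z) ^ 2
   + RtoC ((INR n - 1) * (INR n - 2) / (3 * INR n)) * (z / (1 - z))
   + RtoC ((INR n - 2) / INR n) * (z * (2 - z) / (1 - z) ^ 2)
   + RtoC (4 / (3 * INR n)) * (z * (z ^ 2 - 3 * z + 3) / (1 - z) ^ 3)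
   + log_sum n K (fun _ => 1%R) z)%C.

Definition F_primitive (n K : nat) (z : C) : C :=
  (RtoC ((4 - INR n ^ 2) / (6 * INR n)) * (z / (1 - z))
   - RtoC (2 / INR n) * (z * (2 - z) / (1 - z) ^ 2)
   + RtoC (4 / (3 * INR n)) * (z * (z ^ 2 - 3 * z + 3) / (1 - z) ^ 3)
   + log_sum n K (fun k => ((-1) ^ k)%R) z)%C.

Lemma u_primitive_0 (n K : nat) : u_primitive n K 0 = 0%C.
Proof. unfold u_primitive, Cdiv; rewrite log_sum_0; ring. Qed.

Lemma F_primitive_0 (n K : nat) : F_primitive n K 0 = 0%C.
Proof. unfold F_primitive, Cdiv; rewrite log_sum_0; ring. Qed.

Lemma Cder_u_primitive (n K : nat) (z : C) :
  (1 <= n)%nat -> (n = 2 * K + 1 \/ n = 2 * K + 2)%nat -> disk z ->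
  Cder (u_primitive n K) z (h_derivative n z * (1 + z ^ n))%C.
Proof.
  intros Hn HK Hz.
  pose proof (one_minus_neq_0 z Hz) as H0.
  pose proof (disk_pow_neq_1 n z Hn Hz) as H1.
  pose proof (RtoC_INR_neq_0 n Hn) as HN.
  pose proof RtoC_3_neq_0 as H3.
  pose proof (not_0_INR n ltac:(lia)) as HNr.
  eapply Cder_ext; [| | apply (Cder_plus _ _ _ _ _ (Cder_plus _ _ _ _ _
      (Cder_opp _ _ _ (Cder_koebe z Hz))
      (Cder_polar_primitive (RtoC ((INR n - 1) * (INR n - 2) / (3 * INR n)))
         (RtoC ((INR n - 2) / INR n)) (RtoC (4 / (3 * INR n))) z Hz))
      (Cder_log_sum n K (fun _ => 1) z Hn HK (fun _ _ => eq_refl) Hz))].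
  - intros w; unfold u_primitive, polar_primitive, Cdiv; ring.
  - rewrite (Csum_ext _ (fun k => log_term n k z)) by (intros; ring).
    (* [h' (1 + z^n) = 2 h' - h' (1 - z^n)], and the subtracted term is the derivative of the Koebe
       function; hence the leading [- z / (1 - z)^2]. *)
    replace (h_derivative n z * (1 + z ^ n))%C
      with (2 * (1 + z) / ((1 - z) ^ 3 * (1 - z ^ n)) - (1 + z) / (1 - z) ^ 3)%C
      by (unfold h_derivative; revert H1; set (y := (z ^ n)%C); intros H1; field; auto).
    rewrite partial_fractions by assumption.
    rewrite !RtoC_div, !RtoC_mult, !RtoC_minus by
      (try apply Rmult_integral_contrapositive_currified; lra || exact HNr).
    unfold pole_part; set (L := Csum _ n); set (N := RtoC (INR n)) in *.
    field; auto.
Qed.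

Lemma Cder_F_primitive (m : nat) (z : C) :
  (1 <= m)%nat -> disk z ->
  Cder (F_primitive (2 * m) (m - 1)) z (2 * (h_derivative (2 * m) z * z ^ m))%C.
Proof.
  intros Hm Hz.
  assert (Hn : (1 <= 2 * m)%nat) by lia.
  assert (HK : (2 * m = 2 * (m - 1) + 1 \/ 2 * m = 2 * (m - 1) + 2)%nat) by lia.
  assert (Hs : forall k, (k <= 2 * m)%nat -> (-1) ^ (2 * m - k) = (-1) ^ k).
  { intros k Hk.
    replace ((-1) ^ (2 * m - k))
      with ((-1) ^ (2 * m - k) * ((-1) ^ k * (-1) ^ k)).
    - rewrite <- Rmult_assoc, <- pow_add, Nat.sub_add by exact Hk.
      rewrite pow_1_even; ring.
    - rewrite <- pow_add; replace (k + k)%nat with (2 * k)%nat by lia.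
      rewrite pow_1_even; ring. }
  pose proof (one_minus_neq_0 z Hz) as H0.
  pose proof (disk_pow_neq_1 m z Hm Hz) as H1.
  pose proof (disk_pow_neq_1 (2 * m) z Hn Hz) as H2.
  pose proof (RtoC_INR_neq_0 m Hm) as HM.
  pose proof RtoC_3_neq_0 as H3.
  pose proof (not_0_INR m ltac:(lia)) as HMr.
  assert (EN : INR (2 * m) = 2 * INR m) by (rewrite mult_INR; reflexivity).
  eapply Cder_ext; [| | apply (Cder_plus _ _ _ _ _
      (Cder_polar_primitive (RtoC ((4 - INR (2 * m) ^ 2) / (6 * INR (2 * m))))
         (- RtoC (2 / INR (2 * m)))%C (RtoC (4 / (3 * INR (2 * m)))) z Hz)
      (Cder_log_sum (2 * m) (m - 1) (fun k => (-1) ^ k) z Hn HK Hs Hz))].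
  - intros w; unfold F_primitive, polar_primitive, Cdiv; ring.
  - replace (2 * (h_derivative (2 * m) z * z ^ m))%C
      with (2 * (1 + z) / ((1 - z) ^ 3 * (1 - z ^ m))
            - 2 * (1 + z) / ((1 - z) ^ 3 * (1 - z ^ (2 * m))))%C.
    2:{ unfold h_derivative; revert H2.
        replace (2 * m)%nat with (m + m)%nat by lia; rewrite Cpow_add_r.
        revert H1; set (y := (z ^ m)%C); intros H1' H2'.
        field; auto. }
    rewrite !partial_fractions by assumption.
    (* The [2m]-th roots of even index are the [m]-th roots with the same weights, so the
       alternating sum is twice the sum for [m] minus the sum for [2m]. *)
    pose proof (Csum_double (fun k => log_term (2 * m) k z) m) as HD.
    rewrite (Csum_ext (fun k => log_term (2 * m) (2 * k) z)
               (fun k => log_term m k z)) in HD.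
    2:{ intros k _; unfold log_term; rewrite weight_double, unit_root_double by exact Hm;
        reflexivity. }
    rewrite (Csum_ext _ (fun k => log_term (2 * m) k z
               + RtoC ((-1) ^ k) * log_term (2 * m) k z)%C) in HD.
    2:{ intros k _; rewrite RtoC_plus; ring. }
    rewrite Csum_plus in HD.
    set (L1 := Csum (fun k => log_term m k z) m) in *.
    set (L2 := Csum (fun k => log_term (2 * m) k z) (2 * m)) in *.
    set (L3 := Csum (fun k => RtoC _ * _)%C _) in *.
    replace L1 with ((L2 + L3) / 2)%C by (rewrite HD; field; intros E; apply RtoC_inj in E; lra).
    rewrite EN.
    replace ((4 - (2 * INR m) ^ 2) / (6 * (2 * INR m)))
      with ((1 - INR m * INR m) / (3 * INR m)) by (field; exact HMr).
    rewrite !RtoC_div, !RtoC_minus, !RtoC_mult by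
      (repeat apply Rmult_integral_contrapositive_currified; lra || exact HMr).
    unfold pole_part; set (M := RtoC (INR m)) in *.
    field; repeat split; auto; intros E; apply RtoC_inj in E; lra.
Qed.

(** * The harmonic mapping and its lift *)

Lemma SH0_derivatives (n : nat) (f h g : C -> C) :
  (1 <= n)%nat -> SH0 f h g ->
  (forall z : C, disk z -> (h z - g z = z / (1 - z) ^ 2)%C) ->
  (forall z : C, disk z -> (C_derive g z / C_derive h z = z ^ n)%C) ->
  forall z, disk z ->
    Cder h z (h_derivative n z) /\ Cder g z (h_derivative n z * z ^ n)%C.
Proof.
  intros Hn [Ah [Ag [_ [_ [_ [_ [_ [H1 _]]]]]]]] Hdiff Hdil z Hz.
  pose proof (C_derive_correct h z z (Ah z Hz)) as Hh.
  pose proof (C_derive_correct g z z (Ag z Hz)) as Hg.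
  specialize (Hdil z Hz).
  set (a := C_derive h z) in *; set (b := C_derive g z) in *.
  (* Division by zero gives 0, so [h' z = 0] would force [z^n = 0], hence [z = 0], where [h'] is
     [1]. *)
  assert (Ha : a <> 0%C).
  { intros E; rewrite E in Hdil.
    assert (Hzn : (z ^ n)%C = 0%C).
    { rewrite <- Hdil; unfold Cdiv, Cinv, Cmult, RtoC, Rdiv; simpl.
      f_equal; ring. }
    assert (Hz0 : z = 0%C).
    { destruct (excluded_middle_informative (z = 0%C)) as [E0|N]; [exact E0|].
      destruct (Cpow_nz z n N Hzn). }
    apply C1_nz; rewrite <- H1; unfold a in E; rewrite Hz0 in E; exact E. }
  pose proof (Cder_ext_disk _ _ z _ Hz Hdiff (Cder_minus h g z a b Hh Hg)) as Hk.
  pose proof (Cder_unique _ _ _ _ Hk (Cder_koebe z Hz)) as E.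
  pose proof (one_minus_neq_0 z Hz) as N1.
  pose proof (disk_pow_neq_1 n z Hn Hz) as N2.
  assert (Eb : b = (a * z ^ n)%C) by (rewrite <- Hdil; field; exact Ha).
  assert (Ea : a = h_derivative n z).
  { unfold h_derivative.
    replace a with ((a - b) / (1 - z ^ n))%C
      by (rewrite Eb; revert N2; set (y := (z ^ n)%C); intros N2; field; exact N2).
    rewrite E; revert N2; set (y := (z ^ n)%C); intros N2; field; auto. }
  rewrite <- Ea, <- Eb; split; assumption.
Qed.

Lemma SH0_components (n K : nat) (f h g : C -> C) :
  (1 <= n)%nat -> (n = 2 * K + 1 \/ n = 2 * K + 2)%nat -> SH0 f h g ->
  (forall z : C, disk z -> (h z - g z = z / (1 - z) ^ 2)%C) ->
  (forall z : C, disk z -> (C_derive g z / C_derive h z = z ^ n)%C) ->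
  forall z, disk z -> f z = (u_formula n K z, v_formula z).
Proof.
  intros Hn HK HS Hdiff Hdil z Hz.
  pose proof (SH0_derivatives n f h g Hn HS Hdiff Hdil) as HD.
  destruct HS as [_ [_ [Hf [_ [_ [Hh0 [Hg0 _]]]]]]].
  assert (E : u_primitive n K z = (h z + g z)%C).
  { apply (primitive_unique (u_primitive n K) (fun w => h w + g w)%C
             (fun w => h_derivative n w * (1 + w ^ n))%C).
    - intros w Hw; apply Cder_u_primitive; assumption.
    - intros w Hw; destruct (HD w Hw) as [Dh Dg].
      eapply Cder_ext; [reflexivity | | apply (Cder_plus _ _ _ _ _ Dh Dg)]; ring.
    - intros w Hw.
      assert (S1 : csmooth 1 (fun w => h_derivative n w * (1 + w ^ n))%C).
      { apply csmooth_mult; [apply csmooth_h_derivative, Hn|].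
        apply csmooth_plus; [apply csmooth_const | apply csmooth_pow, csmooth_id]. }
      destruct S1 as [l [Hl _]]; exists (l w); apply Hl, Hw.
    - rewrite u_primitive_0, Hh0, Hg0; ring.
    - exact Hz. }
  unfold v_formula; rewrite <- (Hdiff z Hz).
  change (u_formula n K z) with (Re (u_primitive n K z)); rewrite E.
  rewrite (Hf z Hz).
  destruct (h z), (g z); unfold Cplus, Cconj, Cminus, Copp; simpl; f_equal; ring.
Qed.

Theorem theorem3p2 (n : nat) (hn : (1 <= n)%nat) (f h g : C -> C)
  (hS : SH0 f h g)
  (hdiff : forall z : C, disk z -> (h z - g z = z / (1 - z) ^ 2)%C)
  (hdil : forall z : C, disk z -> (C_derive g z / C_derive h z = z ^ n)%C) :
  (forall m : nat, (1 <= m)%nat -> n = (2 * m + 1)%nat ->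
     forall z : C, disk z ->
       f z = (RtoC (u_formula n ((n - 1) / 2) z) + Ci * RtoC (v_formula z))%C)
  /\
  (forall m : nat, (1 <= m)%nat -> n = (2 * m)%nat ->
     lifts_to_minimal_surface f h g (fun z : C => (z ^ (n / 2))%C)
       (fun z : C => (u_formula n (n / 2 - 1) z, v_formula z,
                      F_formula n (n / 2 - 1) z))).
Proof.
  split.
  - intros m Hm Em z Hz.
    assert (EK : ((n - 1) / 2 = m)%nat).
    { replace (n - 1)%nat with (m * 2)%nat by lia; apply Nat.div_mul; lia. }
    rewrite EK.
    rewrite (SH0_components n m f h g hn (or_introl Em) hS hdiff hdil z Hz).
    unfold RtoC, Ci, Cplus, Cmult; simpl; f_equal; ring.
  - intros m Hm Em.
    assert (EK : (n / 2 = m)%nat).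
    { replace n with (m * 2)%nat by lia; apply Nat.div_mul; lia. }
    rewrite EK.
    assert (HK : (n = 2 * (m - 1) + 1 \/ n = 2 * (m - 1) + 2)%nat) by lia.
    pose proof (SH0_components n (m - 1) f h g hn HK hS hdiff hdil) as Hf.
    pose proof (SH0_derivatives n f h g hn hS hdiff hdil) as HD.
    destruct hS as [_ [_ [_ [Hsp [Huni _]]]]].
    assert (EX : (fun z : C => (u_formula n (m - 1) z, v_formula z, F_formula n (m - 1) z))
      = re_map (u_primitive n (m - 1)) (fun w => - Ci * (w / (1 - w) ^ 2))%C
               (fun w => - Ci * F_primitive n (m - 1) w)%C).
    { apply functional_extensionality; intros w; unfold re_map.
      rewrite <- !Im_as_Re; reflexivity. }
    set (p1 := fun w => (h_derivative n w * (1 + w ^ n))%C).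
    set (p2 := fun w => (- Ci * (h_derivative n w * (1 - w ^ n)))%C).
    set (p3 := fun w => (- Ci * (2 * (h_derivative n w * w ^ m)))%C).
    assert (HF : forall w, disk w ->
      Cder (F_primitive n (m - 1)) w (2 * (h_derivative n w * w ^ m))%C).
    { intros w Hw; rewrite Em; apply Cder_F_primitive; assumption. }
    assert (HP1 : forall w, disk w -> Cder (u_primitive n (m - 1)) w (p1 w)).
    { intros w Hw; apply Cder_u_primitive; assumption. }
    assert (HP2 : forall w, disk w -> Cder (fun w => - Ci * (w / (1 - w) ^ 2))%C w (p2 w)).
    { intros w Hw.
      eapply Cder_ext; [reflexivity | |
        apply (Cder_mult (fun _ => (- Ci)%C) _ w 0); [apply Cder_const | apply Cder_koebe, Hw]].
      unfold p2, h_derivative.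
      pose proof (one_minus_neq_0 w Hw) as N1.
      pose proof (disk_pow_neq_1 n w hn Hw) as N2.
      revert N2; set (y := (w ^ n)%C); intros N2; field; auto. }
    assert (HP3 : forall w, disk w ->
      Cder (fun w => - Ci * F_primitive n (m - 1) w)%C w (p3 w)).
    { intros w Hw.
      eapply Cder_ext; [reflexivity | |
        apply (Cder_mult (fun _ => (- Ci)%C) _ w 0); [apply Cder_const | apply HF, Hw]].
      unfold p3; ring. }
    assert (Hnull : forall w, disk w -> (p1 w ^ 2 + p2 w ^ 2 + p3 w ^ 2 = 0)%C).
    { intros w _; unfold p1, p2, p3.
      replace (w ^ n)%C with (w ^ m * w ^ m)%C
        by (rewrite <- Cpow_add_r; f_equal; lia).
      set (H := h_derivative n w); set (y := (w ^ m)%C).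
      (* With [y = w^m], this is [(1 + y^2)^2 = (1 - y^2)^2 + 4 y^2]. *)
      transitivity ((1 + Ci * Ci) * (H ^ 2 * ((1 - y * y) ^ 2 + 4 * y ^ 2)))%C; [ring|].
      rewrite Ci_sqr; ring. }
    assert (Hsm : forall c : C -> C, csmooth 2 c -> csmooth 2 (fun w => h_derivative n w * c w)%C).
    { intros c Hc; apply csmooth_mult; [apply csmooth_h_derivative, hn | exact Hc]. }
    assert (Hpow : forall k j, csmooth k (fun w => w ^ j)%C)
      by (intros; apply csmooth_pow, csmooth_id).
    (* The formulas agree with [f] only on the disk; it is open and partial derivatives are local,
       so the positive Jacobian of [f] carries over. *)
    assert (Hjac : forall z, disk z ->
      jacobian (fun w => u_formula n (m - 1) w) v_formula z <> 0).
    { intros z Hz; pose proof (Hsp z Hz) as Hpos; unfold jacobian in *.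
      rewrite (Dx_ext_disk (fun w => Re (f w)) (u_formula n (m - 1))),
        (Dy_ext_disk (fun w => Re (f w)) (u_formula n (m - 1))),
        (Dx_ext_disk (fun w => Im (f w)) v_formula),
        (Dy_ext_disk (fun w => Im (f w)) v_formula) in Hpos
        by (exact Hz || (intros w Hw; rewrite (Hf w Hw); reflexivity)).
      apply Rgt_not_eq, Hpos. }
    split; [|split; [|split; [|split; [|split]]]].
    + intros z Hz; destruct (Hpow 1%nat m) as [l [Hl _]]; exists (l z); apply Hl, Hz.
    + intros z Hz; rewrite (hdil z Hz), <- Cpow_mult_r; f_equal; lia.
    + intros z Hz; rewrite (Hf z Hz).
      apply (f_equal2 pair); [reflexivity|].
      (* The derivative of [F_primitive] is [2 h' q], so half of it is the primitive of [h' q]; the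
         factor 2 in front of the integral restores it. *)
      rewrite (Cint0_primitive (fun w => / 2 * F_primitive n (m - 1) w)%C).
      * rewrite F_primitive_0.
        change (F_formula n (m - 1) z) with (Im (F_primitive n (m - 1) z)).
        rewrite Cmult_0_r.
        replace (/ 2 * F_primitive n (m - 1) z - 0)%C
          with (RtoC (/ 2) * F_primitive n (m - 1) z)%C
          by (rewrite RtoC_inv by lra; ring).
        rewrite im_scal_l; field.
      * intros w Hw; destruct (HD w Hw) as [Dh _].
        rewrite (is_C_derive_unique h w _ Dh).
        eapply Cder_ext; [reflexivity | |
          apply (Cder_mult (fun _ => (/ 2)%C) _ w 0); [apply Cder_const | apply HF, Hw]].
        field; intros E; apply RtoC_inj in E; lra.
      * intros w Hw.
        destruct (csmooth_mult 1 _ _ (csmooth_h_derivative 1 n hn) (Hpow 1%nat m))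
          as [l [Hl _]].
        exists (l w).
        apply (Cder_ext_disk (fun w => h_derivative n w * w ^ m)%C);
          [exact Hw | | apply Hl, Hw].
        intros v Hv; destruct (HD v Hv) as [Dh _].
        rewrite (is_C_derive_unique h v _ Dh); reflexivity.
      * exact Hz.
    + rewrite EX; apply (weierstrass_isothermal _ _ _ p1 p2 p3); assumption.
    + rewrite EX; apply (weierstrass_minimal _ _ _ p1 p2 p3); try assumption.
      * apply Hsm, csmooth_plus; [apply csmooth_const | apply Hpow].
      * apply csmooth_mult; [apply csmooth_const|].
        apply Hsm, csmooth_plus; [apply csmooth_const | apply csmooth_opp, Hpow].
      * apply csmooth_mult; [apply csmooth_const|].
        apply csmooth_mult; [apply csmooth_const | apply Hsm, Hpow].
      * intros z Hz.
        replace (fun w : C => Re (- Ci * (w / (1 - w) ^ 2))%C) with v_formula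
          by (apply functional_extensionality; intros w; apply Im_as_Re).
        exact (Hjac z Hz).
    + split; [exact Huni | split; [exact Hf | split; [exact Hjac |]]].
      (* The height over a point of the image is read at a preimage under [f] selected by [epsilon];
         univalence makes this preimage the original [z]. *)
      exists (fun a b => F_formula n (m - 1)
        (epsilon (inhabits (RtoC 0)) (fun w => disk w /\ f w = (a, b)))).
      intros z Hz; unfold crd1, crd2, crd3; simpl.
      rewrite <- (Hf z Hz).
      destruct (epsilon_spec (inhabits (RtoC 0)) (fun w => disk w /\ f w = f z)
                  (ex_intro _ z (conj Hz eq_refl))) as [Hd He].
      rewrite (Huni _ _ Hd Hz He); reflexivity.
Qed.
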